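(* Let $\Bbbk$ be an algebraically closed field of arbitrary characteristic. For every $n\ge 8$, the variety $V_{3,n}$ is not normal.
   Context: A rational normal curve in $\mathbb{P}^3$ (twisted cubic) is the image of the third Veronese embedding $\mathbb{P}^1\hookrightarrow\mathbb{P}^3$ up to projective automorphism. Let $U_{3,n}\subseteq(\mathbb{P}^3)^n$ be the locus of configurations $(p_1,\dots,p_n)$ of $n$ distinct points such that some rational normal curve in $\mathbb{P}^3$ contains all the $p_i$. $V_{3,n}\subseteq(\mathbb{P}^3)^n$ (the Veronese compactification) is the Zariski closure of $U_{3,n}$ with the reduced induced scheme structure. *)

(* Defs.v *)
From HB Require Import structures.
From mathcomp Require Import all_boot all_order all_algebra.
From mathcomp Require Import ring_quotient.
From mathcomp Require Import boolp classical_sets functions.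
From mathcomp Require Import mpoly.

Set Implicit Arguments.
Unset Strict Implicit.
Unset Printing Implicit Defensive.

Import GRing.Theory.
Local Open Scope classical_set_scope.
Local Open Scope ring_scope.

Section ProjectiveSpace.
Variables (k : fieldType) (r : nat).

Definition projspace := {L : {vspace 'rV[k]_r.+1} | \dim L == 1%N}.

HB.instance Definition _ := Choice.on projspace.

Lemma projspace_base_subproof :
  \dim (<[const_mx 1 : 'rV[k]_r.+1]>%VS) == 1%N.
Proof.
rewrite dim_vline; suff -> : (const_mx 1 : 'rV[k]_r.+1) != 0 by [].
by apply/eqP => /rowP /(_ 0); rewrite !mxE => /eqP; rewrite oner_eq0.
Qed.

HB.instance Definition _ :=
  isPointed.Build projspace
    (exist (fun L : {vspace 'rV[k]_r.+1} => \dim L == 1%N) _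
       projspace_base_subproof).

(* Homogeneous coordinates; they are only meaningful up to a nonzero scalar,
   vpick makes an arbitrary choice of a nonzero vector on the line. *)
Definition hcoord (p : projspace) : 'rV[k]_r.+1 := vpick (val p).

End ProjectiveSpace.

Section MultiprojectiveSpace.
Variables (k : fieldType) (r n : nat).

Local Notation X := ('I_n -> projspace k r).

(* The coordinate x_(i,j) is the variable of index mxvec_index i j. *)
Local Notation S := {mpoly k[n * r.+1]}.

Definition multihomog (d : 'I_n -> nat) (f : S) : Prop :=
  forall m, m \in msupp f ->
  forall i, (\sum_(j < r.+1) m (mxvec_index i j))%N = d i.

Definition heval (f : S) (x : X) : k :=
  f.@[fun l => mxvec (\matrix_(i < n) hcoord (x i)) 0 l].

Definition zariski_closed (Z : set X) : Prop :=
  exists2 F : set S, (forall f, F f -> exists d, multihomog d f)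
    & Z = [set x | forall f, F f -> heval f x = 0].

Definition zariski_open (W : set X) : Prop := zariski_closed (~` W).

Definition zariski_closure (A : set X) : set X :=
  [set x | forall Z, zariski_closed Z -> A `<=` Z -> Z x].

Lemma multihomog1 : multihomog (fun=> 0%N) 1.
Proof.
move=> m; rewrite msupp1 inE => /eqP -> i.
by rewrite big1 // => j _; rewrite mnm0E.
Qed.

Lemma multihomogB d f g :
  multihomog d f -> multihomog d g -> multihomog d (f - g).
Proof.
move=> hf hg m /msuppB_le; rewrite mem_cat => /orP[]; first exact: hf.
exact: hg.
Qed.

Lemma multihomogM d e f g : multihomog d f -> multihomog e g ->
  multihomog (fun i => (d i + e i)%N) (f * g).
Proof.
move=> hf hg m /msuppM_le /allpairsP[[m1 m2] /= [h1 h2 ->]] i.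
rewrite -(hf _ h1) -(hg _ h2) -big_split /=.
by apply: eq_bigr => j _; rewrite mnmDE.
Qed.

Lemma heval1 x : heval 1 x = 1.
Proof. exact: meval1. Qed.

Lemma hevalB f g x : heval (f - g) x = heval f x - heval g x.
Proof. exact: mevalB. Qed.

Lemma hevalM f g x : heval (f * g) x = heval f x * heval g x.
Proof. exact: mevalM. Qed.

Lemma zariski_openT : zariski_open setT.
Proof.
exists [set 1]; first by move=> _ ->; exists (fun=> 0%N); exact: multihomog1.
rewrite setCT; apply/seteqP; split=> // x /(_ 1 erefl).
by rewrite heval1 => /eqP; rewrite oner_eq0.
Qed.

Lemma zariski_openI W1 W2 :
  zariski_open W1 -> zariski_open W2 -> zariski_open (W1 `&` W2).
Proof.
move=> [F1 h1 e1] [F2 h2 e2].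
exists [set f | exists2 a, F1 a & exists2 b, F2 b & f = a * b].
  move=> _ [a /h1[d ha] [b /h2[e hb] ->]].
  by exists (fun i => (d i + e i)%N); exact: multihomogM.
rewrite setCI e1 e2; apply/seteqP; split=> x /=.
  case=> h _ [a Fa [b Fb ->]]; rewrite hevalM.
    by rewrite (h _ Fa) mul0r.
  by rewrite (h _ Fb) mulr0.
move=> h; case: (pselect (forall f, F1 f -> heval f x = 0)) => [|ne]; first by left.
right=> b Fb; apply: contrapT => bx0; apply: ne => a Fa.
have /eqP := h (a * b) (ex_intro2 _ _ a Fa (ex_intro2 _ _ b Fb erefl)).
by rewrite hevalM mulf_eq0 => /orP[/eqP //|/eqP /bx0].
Qed.

Section LocalRing.
Variable V : set X.

Definition regular_at (P : X) (f : X -> k) : Prop :=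
  exists W, [/\ zariski_open W, W P & exists d g h,
    [/\ multihomog d g, multihomog d h & forall x, W x -> V x ->
      heval h x != 0 /\ f x = heval g x / heval h x]].

Definition vanishes_near (P : X) (f : X -> k) : Prop :=
  exists W, [/\ zariski_open W, W P & forall x, W x -> V x -> f x = 0].

Definition regular_pred (P : X) : pred (X -> k) := fun f => `[< regular_at P f >].

Lemma regular_subring P : subring_closed (regular_pred P).
Proof.
split.
- apply/asboolP; exists setT; split=> //; first exact: zariski_openT.
  exists (fun=> 0%N), 1, 1; split; [exact: multihomog1|exact: multihomog1|].
  by move=> x _ _; rewrite heval1 oner_neq0 divr1.
- move=> f1 f2 /asboolP[W1 [o1 p1 [d1 [g1 [h1 [G1 H1 E1]]]]]].
  move=> /asboolP[W2 [o2 p2 [d2 [g2 [h2 [G2 H2 E2]]]]]].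
  apply/asboolP; exists (W1 `&` W2); split=> //; first exact: zariski_openI.
  exists (fun i => (d1 i + d2 i)%N), (g1 * h2 - h1 * g2), (h1 * h2).
  split; [|exact: multihomogM|].
    by apply: multihomogB; apply: multihomogM.
  move=> x [w1 w2] vx; have [n1 ef1] := E1 x w1 vx; have [n2 ef2] := E2 x w2 vx.
  rewrite hevalB !hevalM mulf_neq0 //; split=> //.
  transitivity (f1 x - f2 x); first by [].
  by rewrite ef1 ef2 -mulNr addf_div // mulNr [heval g2 x * _]mulrC.
- move=> f1 f2 /asboolP[W1 [o1 p1 [d1 [g1 [h1 [G1 H1 E1]]]]]].
  move=> /asboolP[W2 [o2 p2 [d2 [g2 [h2 [G2 H2 E2]]]]]].
  apply/asboolP; exists (W1 `&` W2); split=> //; first exact: zariski_openI.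
  exists (fun i => (d1 i + d2 i)%N), (g1 * g2), (h1 * h2).
  split; [exact: multihomogM|exact: multihomogM|].
  move=> x [w1 w2] vx; have [n1 ef1] := E1 x w1 vx; have [n2 ef2] := E2 x w2 vx.
  rewrite !hevalM mulf_neq0 //; split=> //.
  transitivity (f1 x * f2 x); first by [].
  by rewrite ef1 ef2 mulf_div.
Qed.

HB.instance Definition _ P :=
  GRing.isSubringClosed.Build (X -> k) (regular_pred P) (regular_subring P).

(* The values of f outside V are irrelevant: they are discarded in the
   quotient local_ring below. *)
Record regular_fun (P : X) := RegularFun {
  regular_val :> X -> k;
  regular_valP : regular_val \in regular_pred P }.

HB.instance Definition _ P := [isSub for @regular_val P].
HB.instance Definition _ P := [Choice of regular_fun P by <:].
HB.instance Definition _ P :=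
  [SubChoice_isSubComNzRing of regular_fun P by <:].

(* P ranges over V, seen as a type, so that the quotient below is nonzero. *)
Definition vanishing_pred (P : V) : pred (regular_fun (val P)) :=
  fun f => `[< vanishes_near (val P) f >].
Arguments vanishing_pred : clear implicits.

Lemma vanishing_idealr P : idealr_closed (vanishing_pred P).
Proof.
split.
- apply/asboolP; exists setT; split=> //; first exact: zariski_openT.
- apply/asboolP => -[W [_ WP /(_ _ WP (set_mem (valP P)))]].
  by move=> /eqP; rewrite oner_eq0.
- move=> a u v /asboolP[W1 [o1 p1 E1]] /asboolP[W2 [o2 p2 E2]].
  apply/asboolP; exists (W1 `&` W2); split=> //; first exact: zariski_openI.
  move=> x [w1 w2] vx.
  transitivity (regular_val a x * regular_val u x + regular_val v x); first by [].
  by rewrite E1 // E2 // mulr0 addr0.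
Qed.

HB.instance Definition _ P :=
  isIdealr.Build (regular_fun (val P)) (vanishing_pred P) (vanishing_idealr P).

Definition local_ring (P : V) : comNzRingType :=
  {ideal_quot (vanishing_pred P : idealr _)}.

End LocalRing.
End MultiprojectiveSpace.

Definition integrally_closed (D : idomainType) : Prop :=
  forall z : {fraction D}, integralOver (@tofrac D) z -> exists a : D, z = tofrac a.

Definition integrally_closed_domain (R : comNzRingType) : Prop :=
  exists (D : idomainType) (phi : {rmorphism R -> D}),
    bijective phi /\ integrally_closed D.

(* V is meant to be Zariski closed, with its reduced structure.
   Over an algebraically closed field it is enough to look at the local rings
   of the closed points, the other ones being localizations of these. *)
Definition normal_variety (k : closedFieldType) (r n : nat)
    (V : set ('I_n -> projspace k r)) : Prop :=
  forall P : V, integrally_closed_domain (local_ring P).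

Section Veronese.
Variables (k : fieldType) (d : nat).

Definition veronese (v : 'rV[k]_2) : 'rV[k]_d.+1 :=
  \row_(j < d.+1) (v 0 0 ^+ (d - j) * v 0 1 ^+ j).

Definition rational_normal_curve (C : set (projspace k d)) : Prop :=
  exists2 A : 'M[k]_d.+1, A \in unitmx &
    C = [set p | exists q : projspace k 1,
                   val p = <[veronese (hcoord q) *m A]>%VS].

Definition veronese_locus (n : nat) : set ('I_n -> projspace k d) :=
  [set p | injective p /\
           exists2 C, rational_normal_curve C & forall i, C (p i)].

Definition veronese_compactification (n : nat) : set ('I_n -> projspace k d) :=
  zariski_closure (@veronese_locus n).

End Veronese.

(* Main.v *)
Require Import Defs.
From mathcomp Require Import all_boot all_order all_algebra.
From HB Require Import structures.
From mathcomp Require Import perm ring_quotient zify.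
From mathcomp Require Import boolp classical_sets functions.
From mathcomp Require Import mpoly.
From Stdlib Require Import Ring.

Set Implicit Arguments.
Unset Strict Implicit.
Unset Printing Implicit Defensive.

Import GRing.Theory.
Local Open Scope classical_set_scope.
Local Open Scope quotient_scope.
Local Open Scope ring_scope.

(** Why the variety is not normal.

    Let z be the cross-ratio of the parameters of the first four points on the
    twisted cubic.  It is a rational function on V, the quotient of products of
    4 x 4 determinants of the coordinates.  It is shown that z is integral over
    the local ring of a certain planar configuration P, and that it tends to 0
    and to 1 along two arcs of V with limit P.  If V were normal, z would be
    regular at P and have a single limit there ([normal_eigen], [arc_limit]).

    The geometric source is that a twisted cubic can degenerate to a plane
    nodal cubic.  Eight general points of a plane lie on a pencil of cubics
    with several nodal members, twelve in general, and each of these is a limit of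
    twisted cubics through points that tend to the given ones: V has several
    branches there.
    The cross-ratio z becomes the cross-ratio of the lines that join four of
    the points to the node.  Here the eight points are taken in a grid
    {x1, x2, x3} x {y1, y2, y3}, and the further points of P equal the eighth
    one.  The pencil is spanned by (X - x1)(X - x2)(X - x3) and
    (Y - y1)(Y - y2)(Y - y3), each made of three concurrent lines.  The arcs tend
    to these two cubics; the nodes are the points at infinity of the two axes,
    so the limits of z are cross-ratios of abscissas and of ordinates.

    Integrality is an elimination argument.  A twisted cubic, projected to the
    plane from (0:0:0:1), is a cubic with a singular point x ([nodal_projection]).
    The coefficients C_j of this cubic and the coordinates of x satisfy
    bihomogeneous equations: the cubic passes through the points and is singular
    at x.  Moreover z [x14][x23] = [x13][x24], where [xij] vanishes if x, p_i, p_j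
    are collinear.  At P these equations together with [x14][x23] = 0 have no
    solution, and even generate all the products C_j x^m with |m| = 7.  By
    Nakayama's argument ([elimination]) the same holds near P: each C_j x^m with
    |m| = 7 is [x14][x23] times a combination, with coefficients regular at P,
    of the C_j x^m with |m| = 5.  Hence multiplication by z sends these latter
    products to combinations of themselves, and z is a root of a characteristic
    polynomial.

    That nothing is left at P is proved by hand.  A cubic through the eight points
    belongs to the pencil ([grid_cubics]), so that only pairs of linear functionals
    on forms of degree 7 remain.  For the grid given by X^3 = 1 and Y^3 = 1 the
    singular points are the vertices of the coordinate triangle, which the lines
    14 and 23 avoid ([node_rels_fermat]); characteristic 3 requires another grid
    ([node_rels_char3]).

    Homogeneous coordinates of the projective space are numbered in the order
    Z, X, Y, W; the points of P have Z = 1 and W = 0, and points are numbered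
    from 0 in the code. *)

(** * Normalization of commutative ring expressions *)

Section RingConstants.
Variable (R : comPzRingType).

(** The carrier and the operations of a ring, sealed as constants: a ring
    expression then has one syntactic form, whatever the path of structures
    through which its operations were inferred. *)
Definition rcarrier : Type := R.
Definition radd (x y : rcarrier) : rcarrier := (x : R) + y.
Definition rmul (x y : rcarrier) : rcarrier := (x : R) * y.
Definition ropp (x : rcarrier) : rcarrier := - (x : R).
Definition rzero : rcarrier := (0 : R).
Definition rone : rcarrier := (1 : R).
Lemma rcarrier_theory :
  ring_theory rzero rone radd rmul (fun x y => radd x (ropp y)) ropp eq.
Proof.
by split; [exact: add0r | exact: addrC | exact: addrA | exact: mul1r
  | exact: mulrC | exact: mulrA | exact: mulrDl | | exact: subrr].
Qed.
Add Ring rr : rcarrier_theory.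
Lemma raddE (x y : R) : x + y = radd x y. Proof. by []. Qed.
Lemma rmulE (x y : R) : x * y = rmul x y. Proof. by []. Qed.
Lemma roppE (x : R) : - x = ropp x. Proof. by []. Qed.
Lemma rzeroE : 0 = rzero. Proof. by []. Qed.
Lemma roneE : 1 = rone. Proof. by []. Qed.
End RingConstants.

Ltac cring R :=
  rewrite ?(exprS, expr0, mulrS, mulr0n);
  rewrite ?(@raddE R) ?(@rmulE R) ?(@roppE R) ?(@rzeroE R) ?(@roneE R);
  match goal with |- @eq _ ?a ?b => change (@eq (rcarrier R) a b) end; ring.

(** * Integrality over a local ring *)

Lemma horner_char_poly (R : comNzRingType) d (B : 'M[R]_d) (z : R) :
  (char_poly B).[z] = \det (z%:M - B).
Proof.
rewrite -horner_evalE -det_map_mx; congr (\det _).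
apply/matrixP => i j; rewrite !mxE /= /horner_eval.
by case: (i == j); rewrite ?mulr1n ?mulr0n !hornerE.
Qed.

(** The hypothesis says that g / h is an eigenvalue of B in the fraction field,
    hence a root of the monic characteristic polynomial of B. *)
Lemma integrally_closed_eigen (R : comNzRingType) (g h : R) d (B : 'M[R]_d) :
  integrally_closed_domain R -> h != 0 -> \det (g%:M - h *: B) = 0 ->
  exists a, g = a * h.
Proof.
case=> D [phi [bphi icD]] h0 eB.
have ph0 : tofrac (phi h) != 0.
  by rewrite tofrac_eq0 -(rmorph0 phi) (inj_eq (bij_inj bphi)).
set z : {fraction D} := tofrac (phi g) / tofrac (phi h).
have [|a za] := icD z.
  exists (char_poly (map_mx phi B)); first exact: char_poly_monic.
  rewrite /root map_char_poly horner_char_poly.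
  set M := _ - _; have : tofrac (phi (\det (g%:M - h *: B))) = 0 by rewrite eB !rmorph0.
  rewrite -!det_map_mx !map_mxB !map_scalar_mx !map_mxZ.
  have -> : (tofrac (phi g))%:M = tofrac (phi h) *: z%:M :> 'M_d.
    by rewrite scale_scalar_mx mulrC divfK.
  rewrite -scalerBr detZ => /eqP; rewrite mulf_eq0 expf_eq0 (negPf ph0) andbF /=.
  by [].
case: bphi => psi phiK psiK; exists (psi a).
apply: (can_inj phiK); rewrite rmorphM psiK; apply/eqP.
by rewrite -(tofrac_eq (phi g)) tofracM -za divfK.
Qed.

Section Local.
Variables (k : closedFieldType) (r n : nat) (V : set ('I_n -> projspace k r)).
Local Notation X := ('I_n -> projspace k r).

(** Evaluation is made a ring morphism so that it commutes with determinants. *)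
Definition reg_eval (P : X) (p : X) (f : regular_fun V P) : k := regular_val f p.

Lemma reg_eval_zmod P p : zmod_morphism (@reg_eval P p).
Proof. by []. Qed.

Lemma reg_eval_monoid P p : monoid_morphism (@reg_eval P p).
Proof. by []. Qed.

HB.instance Definition _ P p :=
  GRing.isZmodMorphism.Build _ _ (@reg_eval P p) (@reg_eval_zmod P p).
HB.instance Definition _ P p :=
  GRing.isMonoidMorphism.Build _ _ (@reg_eval P p) (@reg_eval_monoid P p).

(** The form in which normality is used: regular functions near P whose values
    satisfy the pointwise identity give an identity between germs, to which
    [integrally_closed_eigen] applies. *)
Lemma normal_eigen (P : X) (VP : V P) d (g h : X -> k) (B : 'I_d -> 'I_d -> X -> k) :
  normal_variety V ->
  regular_at V P g -> regular_at V P h -> (forall i j, regular_at V P (B i j)) ->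
  ~ vanishes_near V P h ->
  vanishes_near V P (fun p => \det ((g p)%:M - h p *: \matrix_(i, j) B i j p)) ->
  exists2 a, regular_at V P a & vanishes_near V P (fun p => g p - a p * h p).
Proof.
move=> nV rg rh rB nh vd.
pose Q : V := exist _ P (mem_set VP).
have mk f : regular_at V P f -> f \in regular_pred V P by move=> ?; apply/asboolP.
pose G : regular_fun V (val Q) := RegularFun (mk _ rg).
pose H : regular_fun V (val Q) := RegularFun (mk _ rh).
pose BB : 'M[regular_fun V (val Q)]_d := \matrix_(i, j) RegularFun (mk _ (rB i j)).
pose pq : {rmorphism regular_fun V (val Q) -> local_ring Q} :=
  (\pi_({ideal_quot (@vanishing_pred k r n V Q : idealr _)}) : {rmorphism _ -> _}).
have pq0 f : (pq f = 0) <-> vanishes_near V P f.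
  have -> : (pq f = 0) <-> (f \in @vanishing_pred k r n V Q).
    have e : (f \in @vanishing_pred k r n V Q) = (pq f == pq 0).
      by rewrite -[in LHS](subr0 f) Quotient.idealrBE.
    by rewrite e rmorph0; split=> [->|/eqP].
  by split=> [/asboolP|?] //; apply/asboolP.
have [||a ga] :=
  @integrally_closed_eigen (local_ring Q) (pq G) (pq H) d (map_mx pq BB) (nV Q).
- by apply/eqP => /pq0.
- have -> : (pq G)%:M - pq H *: map_mx pq BB = map_mx pq (G%:M - H *: BB).
    by rewrite map_mxB map_scalar_mx map_mxZ.
  rewrite det_map_mx; apply/pq0; move: vd => [W [oW WP EW]].
  exists W; split=> // p Wp Vp; rewrite -(EW p Wp Vp).
  rewrite -[LHS]/(reg_eval p (\det (G%:M - H *: BB))) -det_map_mx.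
  rewrite map_mxB map_scalar_mx map_mxZ; congr (\det (_ - _ *: _)).
  by apply/matrixP=> i j; rewrite !mxE.
have [a' ea] : exists a', pq a' = a.
  by exists (repr a); rewrite /= reprK.
move: ga; rewrite -{}ea -rmorphM => /eqP; rewrite -subr_eq0 -rmorphB => /eqP/pq0 va.
by exists (regular_val a') => //; apply/asboolP; exact: regular_valP.
Qed.
End Local.

(** * Functions regular at a point *)

Lemma mxvec_index_eq m n (i i' : 'I_m) (j j' : 'I_n) :
  (mxvec_index i j == mxvec_index i' j') = (i == i') && (j == j').
Proof.
rewrite /mxvec_index (inj_eq (@cast_ord_inj _ _ _)) (inj_eq enum_rank_inj).
by [].
Qed.

Section Regular.
Variables (k : closedFieldType) (r n : nat) (V : set ('I_n -> projspace k r)).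
Local Notation X := ('I_n -> projspace k r).
Variables (P : X) (VP : V P).
Local Notation reg := (regular_at V P).

Lemma regB f g : reg f -> reg g -> reg (fun p => f p - g p).
Proof.
move=> rf rg; have [_ hB _] := regular_subring V P.
by apply/asboolP; apply: (hB f g); apply/asboolP.
Qed.

Lemma regM f g : reg f -> reg g -> reg (fun p => f p * g p).
Proof.
move=> rf rg; have [_ _ hM] := regular_subring V P.
by apply/asboolP; apply: (hM f g); apply/asboolP.
Qed.

Lemma multihomogC (c : k) : multihomog (fun=> 0%N) (c%:MP : {mpoly k[n * r.+1]}).
Proof.
move=> m; rewrite msuppC; case: eqP => // _; rewrite inE => /eqP -> i.
by rewrite big1 // => j _; rewrite mnm0E.
Qed.

Lemma reg_cst c : reg (fun=> c).
Proof.
exists setT; split=> //; first exact: zariski_openT.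
exists (fun=> 0%N), c%:MP, 1; split; [exact: multihomogC|exact: multihomog1|].
by move=> x _ _; rewrite heval1 oner_neq0 divr1 /heval mevalC.
Qed.

Lemma regN f : reg f -> reg (fun p => - f p).
Proof.
move=> rf; have -> : (fun p => - f p) = (fun p => 0 - f p).
  by apply/funext => p; rewrite sub0r.
exact: regB (reg_cst 0) rf.
Qed.

Lemma regD f g : reg f -> reg g -> reg (fun p => f p + g p).
Proof.
move=> rf rg; have -> : (fun p => f p + g p) = (fun p => f p - (- g p)).
  by apply/funext => p; rewrite opprK.
exact: regB rf (regN rg).
Qed.

Lemma reg_sum (I : Type) (s : seq I) (F : I -> X -> k) :
  (forall i, reg (F i)) -> reg (fun p => \sum_(i <- s) F i p).
Proof.
move=> rF; elim: s => [|i s IHs].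
  have -> : (fun p => \sum_(i <- [::]) F i p) = fun=> 0.
    by apply/funext => p; rewrite big_nil.
  exact: reg_cst.
have -> : (fun p => \sum_(j <- i :: s) F j p) = fun p => F i p + \sum_(j <- s) F j p.
  by apply/funext => p; rewrite big_cons.
exact: regD.
Qed.

Lemma reg_prod (I : Type) (s : seq I) (F : I -> X -> k) :
  (forall i, reg (F i)) -> reg (fun p => \prod_(i <- s) F i p).
Proof.
move=> rF; elim: s => [|i s IHs].
  have -> : (fun p => \prod_(i <- [::]) F i p) = fun=> 1.
    by apply/funext => p; rewrite big_nil.
  exact: reg_cst.
have -> : (fun p => \prod_(j <- i :: s) F j p) = fun p => F i p * \prod_(j <- s) F j p.
  by apply/funext => p; rewrite big_cons.
exact: regM.
Qed.

Lemma reg_det d (M : 'I_d -> 'I_d -> X -> k) :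
  (forall i j, reg (M i j)) -> reg (fun p => \det (\matrix_(i, j) M i j p)).
Proof.
move=> rM; have -> : (fun p => \det (\matrix_(i, j) M i j p)) =
   fun p => \sum_(s : 'S_d) (-1) ^+ s * \prod_i M i (s i) p.
  apply/funext => p; apply: eq_bigr => s _; congr (_ * _).
  by apply: eq_bigr => i _; rewrite mxE.
by apply: reg_sum => s; apply: regM; [exact: reg_cst|exact: reg_prod].
Qed.

Lemma reg_exp f d : reg f -> reg (fun p => f p ^+ d).
Proof.
move=> rf; elim: d => [|d IHd]; first exact: (reg_cst 1).
have -> : (fun p => f p ^+ d.+1) = fun p => f p * f p ^+ d by apply/funext => p; rewrite exprS.
exact: regM.
Qed.

Lemma zariski_open_forall (W : nat -> set X) d :
  (forall i, zariski_open (W i)) -> zariski_open [set x | forall i, (i < d)%N -> W i x].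
Proof.
move=> oW; elim: d => [|d IHd].
  suff -> : [set x | forall i, (i < 0)%N -> W i x] = setT by exact: zariski_openT.
  by apply/seteqP; split.
suff -> : [set x | forall i, (i < d.+1)%N -> W i x] =
    [set x | forall i, (i < d)%N -> W i x] `&` W d by exact: zariski_openI.
apply/seteqP; split=> x /=.
  by move=> H; split=> [i id|]; apply: H; rewrite ?ltnS // ltnW.
by move=> [H Wd] i; rewrite ltnS leq_eqVlt => /orP[/eqP -> //|/H].
Qed.

Lemma zariski_open_neq0 d (f : {mpoly k[n * r.+1]}) :
  multihomog d f -> zariski_open [set x : X | heval f x != 0].
Proof.
move=> hf; exists [set f]; first by move=> _ ->; exists d.
apply/seteqP; split=> x /=.
  by move=> /negP; rewrite negbK => /eqP e _ ->.
by move=> /(_ f erefl) ->; apply/negP; rewrite eqxx.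
Qed.

Lemma regV f : reg f -> f P != 0 -> reg (fun p => (f p)^-1).
Proof.
move=> [W [oW WP [d [g [h [hg hh E]]]]]] fP.
have [hP fPE] := E P WP VP.
have gP : heval g P != 0 by apply: contraNneq fP => g0; rewrite fPE g0 mul0r.
exists (W `&` [set x | heval g x != 0]); split=> //.
  exact: zariski_openI (zariski_open_neq0 hg).
exists d, h, g; split=> // x [Wx gx] Vx; split=> //.
by have [_ ->] := E x Wx Vx; rewrite invf_div.
Qed.

Lemma reg_neq0 f : reg f -> f P != 0 ->
  exists W, [/\ zariski_open W, W P & forall p, W p -> V p -> f p != 0].
Proof.
move=> [W [oW WP [d [g [h [hg hh E]]]]]] fP.
have [hP fPE] := E P WP VP.
have gP : heval g P != 0 by apply: contraNneq fP => g0; rewrite fPE g0 mul0r.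
exists (W `&` [set x | heval g x != 0]); split=> //.
  exact: zariski_openI (zariski_open_neq0 hg).
move=> x [Wx gx] Vx; have [hx ->] := E x Wx Vx.
by rewrite mulf_neq0 ?invr_eq0.
Qed.

Lemma heval_coord (x : X) i j :
  heval 'X_(mxvec_index i j) x = hcoord (x i) 0 j.
Proof. by rewrite /heval mevalXU mxvecE mxE. Qed.

Lemma multihomogXU i j :
  multihomog (fun i' => (i == i') : nat) ('X_(mxvec_index i j) : {mpoly k[n * r.+1]}).
Proof.
move=> m; rewrite msuppX inE => /eqP -> i'.
rewrite (eq_bigr (fun j' => ((i == i') && (j == j')) : nat)); last first.
  by move=> j' _; rewrite mnm1E mxvec_index_eq.
case: eqP => _; last by rewrite big1.
by rewrite (bigD1 j) //= eqxx big1 ?addn0 // => j' /negPf; rewrite eq_sym => ->.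
Qed.

(** Affine coordinates: unlike those given by [hcoord], they do not depend on the
    choice of a vector on the line. *)
Definition aff (i : 'I_n) (j : 'I_r.+1) (x : X) : k :=
  hcoord (x i) 0 j / hcoord (x i) 0 0.

Lemma reg_aff i j : hcoord (P i) 0 0 != 0 -> reg (aff i j).
Proof.
move=> hP; exists [set x | heval 'X_(mxvec_index i 0) x != 0]; split.
- by have := zariski_open_neq0 (@multihomogXU i 0).
- by rewrite /= heval_coord.
exists (fun i' => (i == i') : nat), 'X_(mxvec_index i j), 'X_(mxvec_index i 0).
split; [exact: multihomogXU|exact: multihomogXU|].
by move=> x /= hx Vx; split=> //; rewrite /aff !heval_coord.
Qed.

End Regular.

(** * Elimination *)

Section Elim.
Variables (k : closedFieldType) (r n : nat) (V : set ('I_n -> projspace k r)).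
Local Notation X := ('I_n -> projspace k r).
Variables (P : X) (VP : V P).
Local Notation reg := (regular_at V P).

Definition reg_mx m d (A : X -> 'M[k]_(m, d)) := forall i j, reg (fun p => A p i j).

Lemma reg_mx_det d (A : X -> 'M[k]_d) : reg_mx A -> reg (fun p => \det (A p)).
Proof.
move=> rA; have -> : (fun p => \det (A p)) = fun p => \det (\matrix_(i, j) A p i j).
  by apply/funext => p; congr (\det _); apply/matrixP=> i j; rewrite mxE.
exact: (reg_det (M := fun i j p => A p i j)).
Qed.

Lemma reg_mx_cst m d (A : 'M[k]_(m, d)) : reg_mx (fun=> A).
Proof. by move=> i j; exact: reg_cst. Qed.

Lemma reg_mx_mul m d e (A : X -> 'M[k]_(m, d)) (B : X -> 'M[k]_(d, e)) :
  reg_mx A -> reg_mx B -> reg_mx (fun p => A p *m B p).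
Proof.
move=> rA rB i j; have -> : (fun p => (A p *m B p) i j) =
    fun p => \sum_l A p i l * B p l j by apply/funext => p; rewrite mxE.
by apply: reg_sum => l; apply: regM.
Qed.

Lemma reg_mx_scale m d f (A : X -> 'M[k]_(m, d)) :
  reg f -> reg_mx A -> reg_mx (fun p => f p *: A p).
Proof.
move=> rf rA i j; have -> : (fun p => (f p *: A p) i j) =
    fun p => f p * A p i j by apply/funext => p; rewrite mxE.
exact: regM.
Qed.

Lemma reg_mx_adj d (A : X -> 'M[k]_d) : reg_mx A -> reg_mx (fun p => \adj (A p)).
Proof.
move=> rA i j; have -> : (fun p => (\adj (A p)) i j) =
    fun p => (-1) ^+ (j + i) * \det (row' j (col' i (A p))).
  by apply/funext => p; rewrite mxE.
apply: regM; first exact: reg_cst.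
apply: reg_mx_det => a b; have -> : (fun p => row' j (col' i (A p)) a b) =
  fun p => A p (lift j a) (lift i b) by apply/funext => p; rewrite !mxE.
exact: rA.
Qed.

(** Near P the function f is a fraction G / H.  Multiplying G by the equations of
    the complement of the neighbourhood gives a closed set that contains all of
    U, hence all of V. *)
Lemma vanishes_dense (U : set X) (f : X -> k) W :
  U `<=` V -> V `<=` zariski_closure U -> reg f ->
  zariski_open W -> W P -> (forall p, W p -> U p -> f p = 0) ->
  vanishes_near V P f.
Proof.
move=> UV VU [W1 [oW1 W1P [d [G [H [hG hH E]]]]]] oW WP fU.
have oW2 := zariski_openI oW oW1; exists (W `&` W1); split=> // p [Wp W1p] Vp.
have [Hp ->] := E p W1p Vp; suff -> : heval G p = 0 by rewrite mul0r.
case: oW2 => F hF eF.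
pose F' : set {mpoly k[n * r.+1]} := [set f | exists2 a, F a & f = a * G].
have zF' : zariski_closed [set x : X | forall f, F' f -> heval f x = 0].
  exists F' => // _ [a Fa ->]; have [e he] := hF a Fa.
  by eexists; exact: multihomogM he hG.
have FG a : F a -> heval a p * heval G p = 0.
  move=> Fa; rewrite -hevalM; apply: (VU p Vp _ zF') => [x Ux _ [b Fb ->]|]; last by exists a.
  rewrite hevalM; case: (pselect (W x /\ W1 x)) => [[Wx W1x]|nW]; last first.
    have : (~` (W `&` W1)) x by [].
    by rewrite eF /= => /(_ b Fb) ->; rewrite mul0r.
  have [Hx fx] := E x W1x (UV x Ux); move: (fU x Wx Ux); rewrite fx => /eqP.
  by rewrite mulf_eq0 invr_eq0 (negPf Hx) orbF => /eqP ->; rewrite mulr0.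
apply: contrapT => Gp; have : (~` (W `&` W1)) p.
  rewrite eF /= => a Fa; have /eqP := FG a Fa.
  by rewrite mulf_eq0 => /orP[/eqP //|/eqP].
by apply; split.
Qed.

(** Nakayama's lemma, pointwise.  Let E p be the matrix of the relations.  The
    hypothesis on P provides a left inverse L of E P, so that L *m E p stays
    invertible for p near P; there E p *m e = dl * S y gives e = dl * B' y with B'
    regular at P.  Then gm * y = G e makes y an eigenvector of G *m B' for the
    eigenvalue gm / dl, which is g / h. *)
Lemma elimination (U : set X) (T Rl Bt : finType)
    (rho : Rl -> T -> X -> k) (sig : Rl -> Bt -> k) (gam : Bt -> T -> X -> k)
    (g h : X -> k) (W0 : set X) :
  U `<=` V -> V `<=` zariski_closure U -> zariski_open W0 -> W0 P ->
  (forall r t, reg (rho r t)) -> (forall b t, reg (gam b t)) -> reg g -> reg h ->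
  (forall v : T -> k, (forall r, \sum_t rho r t P * v t = 0) -> forall t, v t = 0) ->
  (forall p, W0 p -> U p -> exists (e : T -> k) (y : Bt -> k) (dl gm : k),
    [/\ exists t, e t != 0,
        forall r, \sum_t rho r t p * e t = dl * \sum_b sig r b * y b,
        forall b, gm * y b = \sum_t gam b t p * e t
      & g p * dl = h p * gm]) ->
  exists d (B : 'I_d -> 'I_d -> X -> k), (forall i j, reg (B i j)) /\
    vanishes_near V P (fun p => \det ((g p)%:M - h p *: \matrix_(i, j) B i j p)).
Proof.
move=> UV VU oW0 W0P rrho rgam rg rh hker hpt.
pose E p : 'M[k]_(#|Rl|, #|T|) := \matrix_(i, j) rho (enum_val i) (enum_val j) p.
pose G p : 'M[k]_(#|Bt|, #|T|) := \matrix_(i, j) gam (enum_val i) (enum_val j) p.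
pose S : 'M[k]_(#|Rl|, #|Bt|) := \matrix_(i, j) sig (enum_val i) (enum_val j).
have rE : reg_mx E.
  move=> i j; have -> : (fun p => E p i j) = rho (enum_val i) (enum_val j).
    by apply/funext => p; rewrite mxE.
  exact: rrho.
have rG : reg_mx G.
  move=> i j; have -> : (fun p => G p i j) = gam (enum_val i) (enum_val j).
    by apply/funext => p; rewrite mxE.
  exact: rgam.
have sumE (I : finType) (F : I -> k) : \sum_(i < #|I|) F (enum_val i) = \sum_i F i.
  by rewrite [RHS](reindex (@enum_val I I)) //; apply: onW_bij; exact: enum_val_bij.
(* a vector killed by all the relations at P is zero *)
have fullE : row_full (E P).
  rewrite /row_full -mxrank_tr; apply: inj_row_free => v vE.
  have v0 : forall t, v 0 (enum_rank t) = 0.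
    apply: hker => i; have /rowP/(_ (enum_rank i)) := vE; rewrite !mxE => vEi.
    rewrite -[RHS]vEi -[LHS](sumE T); apply: eq_bigr => j _.
    by rewrite !mxE enum_rankK enum_valK mulrC.
  by apply/rowP => j; rewrite -[j]enum_valK v0 mxE.
pose L := pinvmx (E P); pose M p := L *m E p.
have MP : M P = 1%:M by exact: mulVpmx.
have rM : reg_mx M by apply: reg_mx_mul => //; exact: reg_mx_cst.
have dP : \det (M P) != 0 by rewrite MP det1 oner_neq0.
have rD : reg (fun p => \det (M p)) by exact: reg_mx_det.
pose Bm p := G p *m ((\det (M p))^-1 *: \adj (M p)) *m (L *m S).
have rB : reg_mx Bm.
  apply: reg_mx_mul; last exact: reg_mx_cst.
  apply: reg_mx_mul => //; apply: reg_mx_scale; last exact: reg_mx_adj.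
  exact: (regV VP rD dP).
exists #|Bt|, (fun i j p => Bm p i j); split=> //.
have [W1 [oW1 W1P nz]] := reg_neq0 VP rD dP.
apply: (@vanishes_dense U _ (W0 `&` W1)) => //.
- apply: (@reg_mx_det _ (fun p => (g p)%:M - h p *: \matrix_(i, j) Bm p i j)) => i j.
  have -> : (fun p => ((g p)%:M - h p *: \matrix_(i, j) Bm p i j) i j) =
            (fun p => g p * (i == j)%:R - h p * Bm p i j).
    by apply/funext => p; rewrite !mxE mulr_natr.
  by apply: regB; apply: regM => //; exact: reg_cst.
- exact: zariski_openI.
move=> p [W0p W1p] Up; have Mp := nz p W1p (UV p Up).
have [e [y [dl [gm [[t et] hE hG hgh]]]]] := hpt p W0p Up.
pose ev : 'cV[k]_#|T| := \col_j e (enum_val j).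
pose yv : 'cV[k]_#|Bt| := \col_j y (enum_val j).
have Eev : E p *m ev = dl *: (S *m yv).
  apply/colP => i; rewrite !mxE.
  transitivity (\sum_t rho (enum_val i) t p * e t).
    by rewrite -[RHS](sumE T); apply: eq_bigr => j _; rewrite !mxE.
  rewrite hE; congr (_ * _).
  by rewrite -[LHS](sumE Bt); apply: eq_bigr => j _; rewrite !mxE.
have Gev : G p *m ev = gm *: yv.
  apply/colP => i; rewrite !mxE hG.
  by rewrite -[RHS](sumE T); apply: eq_bigr => j _; rewrite !mxE.
have ee : ev = dl *: (((\det (M p))^-1 *: \adj (M p)) *m (L *m S) *m yv).
  have : M p *m ev = dl *: (L *m S *m yv).
    by rewrite /M -mulmxA Eev -scalemxAr -mulmxA.
  move=> /(congr1 (mulmx ((\det (M p))^-1 *: \adj (M p)))).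
  rewrite mulmxA -scalemxAl mul_adj_mx -scalemxAl mul_scalar_mx scalerA mulVf //.
  by rewrite scale1r -!scalemxAr -!mulmxA -!scalemxAl.
(* both dl and y are nonzero because e is *)
have ev0 : ev != 0.
  by apply: contraNneq et => /colP/(_ (enum_rank t)); rewrite !mxE enum_rankK => ->.
have dl0 : dl != 0 by apply: contraNneq ev0 => d0; rewrite ee d0 scale0r.
have yv0 : yv != 0 by apply: contraNneq ev0 => y0; rewrite ee y0 mulmx0 scaler0.
have BmE : \matrix_(i, j) Bm p i j = Bm p by apply/matrixP => i j; rewrite mxE.
have key : g p *: yv = h p *: (Bm p *m yv).
  apply: (scalerI dl0); rewrite scalerA mulrC hgh -scalerA -Gev [in LHS]ee.
  by rewrite -!scalemxAr /Bm !scalerA mulrC -!mulmxA.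
apply/eqP; apply: contraNT yv0 => nd.
have uN : (g p)%:M - h p *: \matrix_(i, j) Bm p i j \in unitmx by rewrite unitmxE unitfE.
rewrite -[yv](mulKmx uN) BmE mulmxBl mul_scalar_mx -scalemxAl key subrr mulmx0.
by [].
Qed.
End Elim.

(** * Polynomial arcs of configurations *)

Section Arc.
Variables (k : closedFieldType) (r n : nat).
Local Notation X := ('I_n -> projspace k r).
Local Notation S := {mpoly k[n * r.+1]}.

Lemma hcoord_line (p : projspace k r) (v : 'rV[k]_r.+1) :
  v != 0 -> val p = <[v]>%VS -> exists2 c, c != 0 & hcoord p = c *: v.
Proof.
move=> v0 pv; have : hcoord p \in <[v]>%VS by rewrite -pv memv_pick.
case/vlineP => c hc; exists c => //.
have : hcoord p != 0 by rewrite vpick0 pv -dimv_eq0 dim_vline v0.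
by rewrite hc scaler_eq0 negb_or => /andP[].
Qed.

Definition aval (f : S) (v : 'I_n -> 'rV[k]_r.+1) : k :=
  f.@[fun l => mxvec (\matrix_(i < n) v i) 0 l].

Lemma heval_scale d f (x : X) (v : 'I_n -> 'rV[k]_r.+1) (c : 'I_n -> k) :
  multihomog d f -> (forall i, hcoord (x i) = c i *: v i) ->
  heval f x = (\prod_i c i ^+ d i) * aval f v.
Proof.
move=> hf hx; rewrite /heval /aval !mevalE mulr_sumr [LHS]big_seq [RHS]big_seq.
apply: eq_bigr => m mf; rewrite [RHS]mulrCA; congr (_ * _).
have prodE (F : 'I_(n * r.+1) -> k) :
    \prod_l F l = \prod_(i < n) \prod_(j < r.+1) F (mxvec_index i j).
  rewrite pair_bigA (reindex (uncurry (@mxvec_index n r.+1))) /=; last exact: curry_mxvec_bij.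
  by apply: eq_bigr => -[i j].
rewrite !prodE. rewrite -big_split; apply: eq_bigr => i _ /=.
rewrite -(hf m mf i) -prodrXr -big_split; apply: eq_bigr => j _ /=.
by rewrite !mxvecE !mxE hx mxE exprMn.
Qed.

(** The values of f along polynomial coordinates, as a polynomial in the parameter. *)
Definition pval (f : S) (v : 'I_n -> 'rV[{poly k}]_r.+1) : {poly k} :=
  \sum_(m <- msupp f) (f@_m)%:P * \prod_l (mxvec (\matrix_(i < n) v i) 0 l) ^+ m l.

Lemma horner_pval f v e :
  (pval f v).[e] = aval f (fun i => map_mx (horner_eval e) (v i)).
Proof.
rewrite /pval /aval mevalE horner_sum; apply: eq_bigr => m _.
rewrite hornerM hornerC horner_prod; congr (_ * _); apply: eq_bigr => l _.
by rewrite horner_exp; case/mxvec_indexP: l => i j; rewrite !mxvecE !mxE.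
Qed.

Lemma poly_cofinite (D p q : {poly k}) : D != 0 ->
  (forall e, D.[e] != 0 -> p.[e] = q.[e]) -> p = q.
Proof.
move=> D0 H; apply/eqP; rewrite -subr_eq0; apply: contraT => pq.
have /closed_nonrootP[e] : D * (p - q) != 0 by rewrite mulf_neq0.
rewrite /root hornerM mulf_eq0 negb_or => /andP[De].
by rewrite !hornerE H // subrr eqxx.
Qed.

(** The arc x is given by the polynomial coordinates v at the parameters that are
    not roots of D; its limit P at the parameter 0 may well lie outside of the
    locus swept by the arc. *)
Variables (v : 'I_n -> 'rV[{poly k}]_r.+1) (D : {poly k}) (x : k -> X) (P : X).
Local Notation vat e i := (map_mx (horner_eval e) (v i)).
Hypotheses (D0 : D != 0)
  (xv : forall e, D.[e] != 0 -> forall i, vat e i != 0 /\ val (x e i) = <[vat e i]>%VS)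
  (Pv : forall i, vat 0 i != 0 /\ val (P i) = <[vat 0 i]>%VS).

(** One scalar serves for all the forms of the same multidegree; it disappears in
    quotients. *)
Lemma heval_line (d : 'I_n -> nat) (y : X) e :
  (forall i, vat e i != 0 /\ val (y i) = <[vat e i]>%VS) ->
  exists c : 'I_n -> k, (\prod_i c i ^+ d i) != 0 /\
   forall f : S, multihomog d f -> heval f y = (\prod_i c i ^+ d i) * (pval f v).[e].
Proof.
move=> yv.
have /choice[c hc] : forall i, exists c, c != 0 /\ hcoord (y i) = c *: vat e i.
  by move=> i; have [vi yi] := yv i; have [c] := hcoord_line vi yi; exists c.
exists c; split.
  by apply/prodf_neq0 => i _; rewrite expf_neq0 //; have [] := hc i.
move=> f' hf'; rewrite (heval_scale (v := fun i => vat e i) (c := c) hf') ?horner_pval //.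
by move=> i; have [] := hc i.
Qed.

Lemma arc_open W : zariski_open W -> W P ->
  exists2 D', D' != 0 & forall e, D'.[e] != 0 -> W (x e).
Proof.
move=> [F hF eF] WP.
have [f Ff fP] : exists2 f, F f & heval f P != 0.
  apply: contrapT => nf; have : (~` W) P; last by apply.
  rewrite eF => f Ff /=; apply: contrapT => /eqP fP; apply: nf; by exists f.
have [d hf] := hF f Ff.
have [c [c0 hc]] := heval_line d Pv.
have pf : pval f v != 0.
  by apply: contraNneq fP => p0; rewrite hc // p0 horner0 mulr0.
exists (D * pval f v) => [|e]; first by rewrite mulf_neq0.
rewrite hornerM mulf_eq0 negb_or => /andP[De fe].
have [c' [c'0 hc']] := heval_line d (xv De).
apply: contrapT => nW; have : (~` W) (x e) by [].
by rewrite eF => /(_ f Ff) /eqP; rewrite hc' // mulf_eq0 (negPf c'0) (negPf fe).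
Qed.

Lemma arc_exists W : zariski_open W -> W P -> exists2 e, D.[e] != 0 & W (x e).
Proof.
move=> oW WP; have [D' D'0 H] := arc_open oW WP.
have /closed_nonrootP[e] : D * D' != 0 by rewrite mulf_neq0.
rewrite /root hornerM mulf_eq0 negb_or => /andP[De D'e].
by exists e => //; exact: H.
Qed.

Lemma arc_closure U : (forall e, D.[e] != 0 -> U (x e)) -> zariski_closure U P.
Proof.
move=> xU Z zZ UZ; apply: contrapT => nZ.
have oW : zariski_open (~` Z) by rewrite /zariski_open setCK.
have [e De] := arc_exists oW nZ.
by apply; apply/UZ/xU.
Qed.

(** A regular function a is locally a quotient G / H of forms of the same
    multidegree, so a * den = num gives G * den = num * H up to scalars that cancel.
    As an identity between polynomials in the parameter it extends to 0. *)
Lemma arc_limit (V : set X) a (num den : {poly k}) W :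
  V P -> (forall e, D.[e] != 0 -> V (x e)) -> regular_at V P a ->
  zariski_open W -> W P ->
  (forall e, D.[e] != 0 -> W (x e) -> a (x e) * den.[e] = num.[e]) ->
  a P * den.[0] = num.[0].
Proof.
move=> VP xV [W1 [oW1 W1P [d [G [H [hG hH E]]]]]] oW WP aE.
have [D' D'0 xW] := arc_open (zariski_openI oW oW1) (conj WP W1P).
have GH : pval G v * den = num * pval H v.
  apply: (@poly_cofinite (D * D')); first by rewrite mulf_neq0.
  move=> e; rewrite hornerM mulf_eq0 negb_or => /andP[De /xW[We W1e]].
  have [c [c0 hc]] := heval_line d (xv De).
  have [He aGH] := E _ W1e (xV e De).
  rewrite !hornerM -(aE e De We) aGH !hc //.
  move: He; rewrite hc // mulf_eq0 (negPf c0) /= => He.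
  by rewrite -mulf_div divff // mul1r mulrAC divfK.
have [c [c0 hc]] := heval_line d Pv.
have [HP aGH] := E P W1P VP.
move: HP; rewrite aGH !hc // mulf_eq0 (negPf c0) /= => H0.
have := congr1 (fun p => p.[0]) GH; rewrite /= !hornerM => e.
by rewrite -mulf_div divff // mul1r mulrAC e mulfK.
Qed.

End Arc.

(** * Determinants and plane cubics *)

Section Forms.
Variable k : fieldType.
Add Ring kringPB : (rcarrier_theory k).

Lemma det_nat_expand n (F : nat -> nat -> k) :
  \det (\matrix_(i < n.+1, j < n.+1) F i j) = \sum_(j < n.+1)
    (-1) ^+ j * F 0%N j * \det (\matrix_(a < n, b < n) F a.+1 (bump j b)).
Proof.
rewrite (expand_det_row _ 0); apply: eq_bigr => j _.
rewrite mxE /cofactor mulrCA mulrA add0n; congr (_ * \det _).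
by apply/matrixP => a b; rewrite !mxE.
Qed.

Lemma det_nat2 (F : nat -> nat -> k) :
  \det (\matrix_(i < 2, j < 2) F i j) = F 0%N 0%N * F 1%N 1%N - F 0%N 1%N * F 1%N 0%N.
Proof.
rewrite det_nat_expand !big_ord_recr big_ord0 /= !det_mx11 !mxE /bump /= ?addn0 ?add0n ?add1n.
cring k.
Qed.

Lemma det_nat4 (F : nat -> nat -> k) :
  let d3 i j l a b c := F i a * (F j b * F l c - F j c * F l b)
     - F i b * (F j a * F l c - F j c * F l a) + F i c * (F j a * F l b - F j b * F l a) in
  \det (\matrix_(i < 4, j < 4) F i j) =
   F 0%N 0%N * d3 1%N 2%N 3%N 1%N 2%N 3%N - F 0%N 1%N * d3 1%N 2%N 3%N 0%N 2%N 3%N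
   + F 0%N 2%N * d3 1%N 2%N 3%N 0%N 1%N 3%N
   - F 0%N 3%N * d3 1%N 2%N 3%N 0%N 1%N 2%N.
Proof.
rewrite det_nat_expand !big_ord_recr big_ord0 /=.
rewrite !(det_nat_expand _ (fun a b => F a.+1 (bump _ b))) !big_ord_recr !big_ord0 /=.
rewrite !(det_nat2 (fun a b => F a.+2 (bump _ (bump _ b)))) /bump /= ?addn0 ?add0n ?add1n.
cring k.
Qed.

Definition wedge (a b : nat -> k) i j := a i * b j - a j * b i.

Lemma det_homog_vandermonde (s a b : nat -> k) :
  \det (\matrix_(i < 4, j < 4) (s i * (a i ^+ (3 - j) * b i ^+ j))) =
  s 0%N * s 1%N * s 2%N * s 3%N *
  (wedge a b 0%N 1%N * wedge a b 0%N 2%N * wedge a b 0%N 3%N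
   * wedge a b 1%N 2%N * wedge a b 1%N 3%N * wedge a b 2%N 3%N).
Proof.
rewrite (det_nat4 (fun i j => s i * (a i ^+ (3 - j) * b i ^+ j))) /wedge /subn /=.
cring k.
Qed.

(** A cubic form in Z, X, Y is stored as the function that sends (u, v) to its
    coefficient of X^u Y^v Z^(3-u-v).  Its pairings with [cubic_mon], [cubic_monX],
    [cubic_monY], [cubic_monZ] are its value and its partial derivatives. *)
Definition cpair (c w : nat -> nat -> k) : k := \sum_(u < 4) \sum_(v < 4) c u v * w u v.

Definition cubic_mon (z x y : k) (u v : nat) : k := x ^+ u * y ^+ v * z ^+ (3 - u - v).
Definition cubic_monX z x y u v : k := u%:R * (x ^+ u.-1 * y ^+ v * z ^+ (3 - u - v)).
Definition cubic_monY z x y u v : k := v%:R * (x ^+ u * y ^+ v.-1 * z ^+ (3 - u - v)).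
Definition cubic_monZ z x y u v : k := (3 - u - v)%:R * (x ^+ u * y ^+ v * z ^+ (3 - u - v).-1).

(** The coefficients of the product of three linear forms. *)
Definition triple_prod (l m n : nat -> k) (u v : nat) : k :=
  match u, v with
  | 0, 0 => l 0%N * m 0%N * n 0%N
  | 1, 0 => l 1%N * m 0%N * n 0%N + l 0%N * m 1%N * n 0%N + l 0%N * m 0%N * n 1%N
  | 0, 1 => l 2%N * m 0%N * n 0%N + l 0%N * m 2%N * n 0%N + l 0%N * m 0%N * n 2%N
  | 2, 0 => l 1%N * m 1%N * n 0%N + l 1%N * m 0%N * n 1%N + l 0%N * m 1%N * n 1%N
  | 0, 2 => l 2%N * m 2%N * n 0%N + l 2%N * m 0%N * n 2%N + l 0%N * m 2%N * n 2%N
  | 1, 1 => l 0%N * (m 1%N * n 2%N + m 2%N * n 1%N) + m 0%N * (l 1%N * n 2%N + l 2%N * n 1%N)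
            + n 0%N * (l 1%N * m 2%N + l 2%N * m 1%N)
  | 3, 0 => l 1%N * m 1%N * n 1%N
  | 2, 1 => l 1%N * m 1%N * n 2%N + l 1%N * m 2%N * n 1%N + l 2%N * m 1%N * n 1%N
  | 1, 2 => l 2%N * m 2%N * n 1%N + l 2%N * m 1%N * n 2%N + l 1%N * m 2%N * n 2%N
  | 0, 3 => l 2%N * m 2%N * n 2%N
  | _, _ => 0%R
  end.

Definition lin (l : nat -> k) z x y := l 0%N * z + l 1%N * x + l 2%N * y.

Lemma triple_prod_mon l m n z x y :
  cpair (triple_prod l m n) (cubic_mon z x y) = lin l z x y * lin m z x y * lin n z x y.
Proof.
rewrite /cpair !big_ord_recr !big_ord0 /= /cubic_mon /lin /subn /=.
cring k.
Qed.
Lemma triple_prod_monX l m n z x y :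
  cpair (triple_prod l m n) (cubic_monX z x y) = l 1%N * lin m z x y * lin n z x y
    + lin l z x y * m 1%N * lin n z x y + lin l z x y * lin m z x y * n 1%N.
Proof.
rewrite /cpair !big_ord_recr !big_ord0 /= /cubic_monX /lin /subn /=.
cring k.
Qed.
Lemma triple_prod_monY l m n z x y :
  cpair (triple_prod l m n) (cubic_monY z x y) = l 2%N * lin m z x y * lin n z x y
    + lin l z x y * m 2%N * lin n z x y + lin l z x y * lin m z x y * n 2%N.
Proof.
rewrite /cpair !big_ord_recr !big_ord0 /= /cubic_monY /lin /subn /=.
cring k.
Qed.
Lemma triple_prod_monZ l m n z x y :
  cpair (triple_prod l m n) (cubic_monZ z x y) = l 0%N * lin m z x y * lin n z x y
    + lin l z x y * m 0%N * lin n z x y + lin l z x y * lin m z x y * n 0%N.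
Proof.
rewrite /cpair !big_ord_recr !big_ord0 /= /cubic_monZ /lin /subn /=.
cring k.
Qed.
End Forms.

(** * The plane projection of a twisted cubic *)

Section Node.
Variable k : fieldType.
Add Ring kringPN : (rcarrier_theory k).

(** For two points this is the equation of the line through them; for two
    equations of lines, their common point. *)
Definition cross (l m : nat -> k) (j : nat) : k :=
  match j with
  | 0 => l 1%N * m 2%N - l 2%N * m 1%N
  | 1 => l 2%N * m 0%N - l 0%N * m 2%N
  | _ => l 0%N * m 1%N - l 1%N * m 0%N
  end.

Section NodalCubic.
Variables (l m p : nat -> k) (Q R : nat -> k).

(** The cubic p * Q(l, m) = R(l, m), where l, m, p are linear forms.  It is
    singular where l = m = 0, and it is parametrized by
    (l, m, p) = (s Q(s, t), t Q(s, t), R(s, t)). *)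
Definition nodal_cubic (u v : nat) : k :=
  Q 0%N * triple_prod p l l u v + Q 1%N * triple_prod p l m u v + Q 2%N * triple_prod p m m u v
  - (R 0%N * triple_prod l l l u v + R 1%N * triple_prod l l m u v
     + R 2%N * triple_prod l m m u v + R 3%N * triple_prod m m m u v).

Definition quad s t : k := Q 0%N * s ^+ 2 + Q 1%N * (s * t) + Q 2%N * t ^+ 2.

Lemma cpair_nodal w : cpair nodal_cubic w =
  Q 0%N * cpair (triple_prod p l l) w + Q 1%N * cpair (triple_prod p l m) w
  + Q 2%N * cpair (triple_prod p m m) w
  - (R 0%N * cpair (triple_prod l l l) w + R 1%N * cpair (triple_prod l l m) w
     + R 2%N * cpair (triple_prod l m m) w + R 3%N * cpair (triple_prod m m m) w).
Proof.
rewrite /nodal_cubic /cpair; rewrite !mulr_sumr -!big_split -sumrB.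
apply: eq_bigr => u _ /=; rewrite !mulr_sumr -!big_split -sumrB.
apply: eq_bigr => v _ /=; cring k.
Qed.

Lemma nodal_cubic_deg u v : (3 < u + v)%N -> nodal_cubic u v = 0.
Proof.
move=> uv; have t0 a b c : triple_prod a b c u v = 0 :> k.
  by case: u uv => [|[|[|[|u]]]]; case: v => [|[|[|[|v]]]].
by rewrite /nodal_cubic !t0 !mulr0 !addr0 subrr.
Qed.

Lemma nodal_cubic_sing z x y : lin l z x y = 0 -> lin m z x y = 0 ->
  [/\ cpair nodal_cubic (cubic_mon z x y) = 0, cpair nodal_cubic (cubic_monX z x y) = 0,
      cpair nodal_cubic (cubic_monY z x y) = 0 & cpair nodal_cubic (cubic_monZ z x y) = 0].
Proof.
move=> l0 m0; split; rewrite cpair_nodal.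
- by rewrite !triple_prod_mon l0 m0; cring k.
- by rewrite !triple_prod_monX l0 m0; cring k.
- by rewrite !triple_prod_monY l0 m0; cring k.
- by rewrite !triple_prod_monZ l0 m0; cring k.
Qed.

Lemma nodal_cubic_eval z x y : let s := lin l z x y in let t := lin m z x y in
  cpair nodal_cubic (cubic_mon z x y) = lin p z x y * quad s t
   - (R 0%N * s ^+ 3 + R 1%N * (s ^+ 2 * t) + R 2%N * (s * t ^+ 2) + R 3%N * t ^+ 3).
Proof.
move=> s t; rewrite cpair_nodal !triple_prod_mon -/s -/t /quad.
cring k.
Qed.

Lemma nodal_cubic_neq0 : lin p (cross l m 0) (cross l m 1) (cross l m 2) != 0 ->
  (exists j, Q (nat_of_ord (j : 'I_3)) != 0) ->
  exists u v : 'I_4, nodal_cubic u v != 0.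
Proof.
set D := lin p _ _ _ => D0 [j Qj]; apply: contrapT => c0.
have cz w : cpair nodal_cubic w = 0.
  rewrite /cpair big1 // => u _; rewrite big1 // => v _.
  have [-> |ne] := eqVneq (nodal_cubic u v) 0; first by rewrite mul0r.
  by case: c0; exists u, v.
(* moving a point along the node direction only changes the value of [p] *)
have Qz z x y : quad (lin l z x y) (lin m z x y) = 0.
  have e1 := nodal_cubic_eval z x y.
  have e2 := nodal_cubic_eval (z + cross l m 0) (x + cross l m 1) (y + cross l m 2).
  rewrite !cz /= in e1 e2.
  have el : lin l (z + cross l m 0) (x + cross l m 1) (y + cross l m 2) = lin l z x y.
    by rewrite /lin /cross; cring k.
  have em : lin m (z + cross l m 0) (x + cross l m 1) (y + cross l m 2) = lin m z x y.
    by rewrite /lin /cross; cring k.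
  have ep : lin p (z + cross l m 0) (x + cross l m 1) (y + cross l m 2) = lin p z x y + D.
    by rewrite /D /lin; cring k.
  rewrite el em ep mulrDl in e2.
  apply: (mulfI D0); rewrite mulr0.
  set q := quad _ _ in e1 e2 *; set pv := lin p z x y in e1 e2 *.
  set rv := (R _ * _ + _ + _ + _) in e1 e2.
  transitivity ((pv * q + D * q - rv) - (pv * q - rv)); first by cring k.
  by rewrite -e1 -e2 subrr.
have [z1 z2] : quad D 0 = 0 /\ quad 0 D = 0.
  split.
    have := Qz (cross m p 0) (cross m p 1) (cross m p 2).
    have -> : lin m (cross m p 0) (cross m p 1) (cross m p 2) = 0.
      by rewrite /lin /cross; cring k.
    have -> // : lin l (cross m p 0) (cross m p 1) (cross m p 2) = D.
    by rewrite /D /lin /cross; cring k.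
  have := Qz (cross p l 0) (cross p l 1) (cross p l 2).
  have -> : lin l (cross p l 0) (cross p l 1) (cross p l 2) = 0.
    by rewrite /lin /cross; cring k.
  have -> // : lin m (cross p l 0) (cross p l 1) (cross p l 2) = D.
  by rewrite /D /lin /cross; cring k.
have z3 : quad D D = 0.
  pose w j := cross m p j + cross p l j; have := Qz (w 0%N) (w 1%N) (w 2%N).
  have -> : lin l (w 0%N) (w 1%N) (w 2%N) = D.
    by rewrite /D /w /lin /cross; cring k.
  have -> // : lin m (w 0%N) (w 1%N) (w 2%N) = D.
  by rewrite /D /w /lin /cross; cring k.
have D2 : D ^+ 2 != 0 by rewrite expf_neq0.
have Q0 : Q 0%N = 0.
  apply: (mulIf D2); rewrite mul0r -[RHS]z1 /quad; cring k.
have Q2 : Q 2%N = 0.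
  apply: (mulIf D2); rewrite mul0r -[RHS]z2 /quad; cring k.
have Q1 : Q 1%N = 0.
  apply: (mulIf D2); rewrite mul0r -[RHS]z3 /quad Q0 Q2; cring k.
case/negP: Qj; case: j => [[|[|[|//]]]] /= _; by rewrite ?Q0 ?Q1 ?Q2.
Qed.
End NodalCubic.

Definition row_coord (y : 'rV[k]_4) (j : nat) : k := y 0 (inord j).

Lemma sum_ord4 (F : 'I_4 -> k) :
  \sum_i F i = F (inord 0) + F (inord 1) + F (inord 2) + F (inord 3).
Proof.
rewrite !big_ord_recr big_ord0 /= add0r.
by congr (F _ + F _ + F _ + F _); apply/val_inj; rewrite /= inordK.
Qed.

Lemma sum_ord3 (F : 'I_3 -> k) :
  \sum_i F i = F (inord 0) + F (inord 1) + F (inord 2).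
Proof.
rewrite !big_ord_recr big_ord0 /= add0r.
by congr (F _ + F _ + F _); apply/val_inj; rewrite /= inordK.
Qed.

Lemma veroneseE (v : 'rV[k]_2) (w : 'cV[k]_4) : (veronese 3 v *m w) 0 0 =
  v 0 0 ^+ 3 * w (inord 0) 0 + v 0 0 ^+ 2 * v 0 1 * w (inord 1) 0
  + v 0 0 * v 0 1 ^+ 2 * w (inord 2) 0 + v 0 1 ^+ 3 * w (inord 3) 0.
Proof. rewrite mxE sum_ord4 !mxE !inordK //=; cring k. Qed.

(** The first three coordinates of the curve span the kernel of a linear functional
    kappa on binary cubics.  Some nonzero binary quadratic form Q satisfies
    kappa (s Q) = kappa (t Q) = 0, so s Q and t Q are the values on the curve of two
    linear forms l and m of the plane.  Their common zero x is the node, and the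
    line from x to the point of parameter (s : t) depends on (s : t) linearly; this
    is the last identity. *)
Lemma nodal_projection (A : 'M[k]_4) : A \in unitmx ->
  exists (x : nat -> k) (c : nat -> nat -> k) (q : 'rV[k]_2 -> k),
  [/\ exists j : 'I_3, x j != 0,
      exists u v : 'I_4, c u v != 0,
      forall u v, (3 < u + v)%N -> c u v = 0,
      forall v, let y := row_coord (veronese 3 v *m A) in
        cpair c (cubic_mon (y 0%N) (y 1%N) (y 2%N)) = 0
    & [/\ cpair c (cubic_mon (x 0%N) (x 1%N) (x 2%N)) = 0,
          cpair c (cubic_monX (x 0%N) (x 1%N) (x 2%N)) = 0,
          cpair c (cubic_monY (x 0%N) (x 1%N) (x 2%N)) = 0,
          cpair c (cubic_monZ (x 0%N) (x 1%N) (x 2%N)) = 0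
        & forall v w,
          lin (cross (row_coord (veronese 3 v *m A)) (row_coord (veronese 3 w *m A)))
            (x 0%N) (x 1%N) (x 2%N)
          = q v * q w * (v 0 0 * w 0 1 - v 0 1 * w 0 0)]].
Proof.
move=> uA.
(* kappa is the last row of the inverse of A, and K encodes the conditions on Q *)
pose K : 'M[k]_(3, 2) := \matrix_(i < 3, j < 2) invmx A (inord 3) (inord (i + j)).
have /rowV0Pn[Q QK Qn0] : kermx K != 0.
  rewrite -mxrank_eq0 mxrank_ker subn_eq0 -ltnNge.
  exact: leq_ltn_trans (rank_leq_col K) _.
have {}QK : Q *m K = 0 by apply/sub_kermxP.
pose Qf (j : nat) := Q 0 (inord j).
pose sQ : 'cV[k]_4 := \col_(i < 4) nth 0 [:: Qf 0%N; Qf 1%N; Qf 2%N; 0] i.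
pose tQ : 'cV[k]_4 := \col_(i < 4) nth 0 [:: 0; Qf 0%N; Qf 1%N; Qf 2%N] i.
pose L := invmx A *m sQ; pose M := invmx A *m tQ.
pose l (j : nat) := L (inord j) 0; pose m (j : nat) := M (inord j) 0.
have AL : A *m L = sQ by rewrite mulKVmx.
have AM : A *m M = tQ by rewrite mulKVmx.
have L3 : L (inord 3) 0 = 0.
  have /rowP/(_ 0) := QK; rewrite !mxE sum_ord3 !mxE !inordK //= => K0.
  rewrite !addn0 in K0; rewrite sum_ord4 !mxE !inordK //= mulr0 addr0 -[RHS]K0 /Qf; cring k.
have M3 : M (inord 3) 0 = 0.
  have /rowP/(_ 1) := QK; rewrite !mxE sum_ord3 !mxE !inordK //= => K0.
  rewrite !addn1 in K0; rewrite sum_ord4 !mxE !inordK //= mulr0 add0r -[RHS]K0 /Qf; cring k.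
have linL y : (y *m L) 0 0 = lin l (row_coord y 0) (row_coord y 1) (row_coord y 2).
  by rewrite [LHS]mxE sum_ord4 L3 mulr0 addr0 ![y _ _ * _]mulrC.
have linM y : (y *m M) 0 0 = lin m (row_coord y 0) (row_coord y 1) (row_coord y 2).
  by rewrite [LHS]mxE sum_ord4 M3 mulr0 addr0 ![y _ _ * _]mulrC.
pose at_curve (h : nat -> k) (v : 'rV[k]_2) := let y := row_coord (veronese 3 v *m A) in
  lin h (y 0%N) (y 1%N) (y 2%N).
have sE v : at_curve l v
   = v 0 0 * quad Qf (v 0 0) (v 0 1).
  rewrite /at_curve -linL -mulmxA AL veroneseE !mxE !inordK // /quad /=; cring k.
have tE v : at_curve m v
   = v 0 1 * quad Qf (v 0 0) (v 0 1).
  rewrite /at_curve -linM -mulmxA AM veroneseE !mxE !inordK // /quad /=; cring k.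
have [j0 Qj0] : exists j : 'I_3, Qf j != 0.
  apply: contrapT => Q0; case/eqP: Qn0; apply/rowP => j; rewrite mxE.
  apply: contrapT => /eqP Qj; case: Q0; exists j.
  by rewrite /Qf inord_val.
(* s Q and t Q are not proportional, hence neither are l and m *)
have [j xj] : exists j : 'I_3, cross l m j != 0.
  apply: contrapT => cz.
  have c0 (i : nat) : (i < 3)%N -> cross l m i = 0.
    move=> i3; apply: contrapT => /eqP ci; case: cz; by exists (Ordinal i3).
  have e0 : l 1%N * m 2%N = l 2%N * m 1%N.
    by apply/eqP; rewrite -subr_eq0; apply/eqP/(c0 0%N isT).
  have e1 : l 2%N * m 0%N = l 0%N * m 2%N.
    by apply/eqP; rewrite -subr_eq0; apply/eqP/(c0 1%N isT).
  have e2 : l 0%N * m 1%N = l 1%N * m 0%N.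
    by apply/eqP; rewrite -subr_eq0; apply/eqP/(c0 2%N isT).
  have lm (i a : nat) : (i < 3)%N -> (a < 3)%N -> m i * l a = l i * m a.
    case: i => [|[|[|i]]] i3; last (by lia); case: a => [|[|[|a]]] a3;
      by [lia | rewrite [LHS]mulrC ?e0 ?e1 ?e2].
  have LM (i : nat) : (i < 3)%N -> m i *: L = l i *: M.
    move=> i3; apply/colP => a; rewrite mxE [RHS]mxE -[a]inord_val.
    have [a3|] := ltnP a 3; first exact: lm.
    rewrite leq_eqVlt ltnNge -ltnS ltn_ord orbF => /eqP <-.
    by rewrite L3 M3 !mulr0.
  have LMe (i : nat) (a : nat) : (i < 3)%N -> (a < 4)%N ->
      m i * nth 0 [:: Qf 0%N; Qf 1%N; Qf 2%N; 0] a
      = l i * nth 0 [:: 0; Qf 0%N; Qf 1%N; Qf 2%N] a.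
    move=> i3 a4; have := congr1 (mulmx A) (LM i i3).
    by rewrite -!scalemxAr AL AM => /colP/(_ (inord a)); rewrite !mxE inordK.
  have lm0 (i : nat) : (i < 3)%N -> l i = 0 /\ m i = 0.
    move=> i3; have := (LMe i 0 i3 isT, LMe i 1 i3 isT, LMe i 2 i3 isT, LMe i 3 i3 isT).
    rewrite /= !mulr0 => -[[[a0 a1] a2] a3].
    have [Q0|Q0] := eqVneq (Qf 0%N) 0; last first.
      have mi : m i = 0 by apply: (mulIf Q0); rewrite mul0r.
      by split=> //; apply: (mulIf Q0); rewrite mul0r -a1 mi mul0r.
    have [Q1|Q1] := eqVneq (Qf 1%N) 0; last first.
      have mi : m i = 0 by apply: (mulIf Q1); rewrite mul0r a1 Q0 mulr0.
      by split=> //; apply: (mulIf Q1); rewrite mul0r -a2 mi mul0r.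
    have Q2 : Qf 2%N != 0.
      by case: j0 Qj0 => [[|[|[|//]]]] /= _; rewrite ?Q0 ?Q1 ?eqxx.
    split; apply: (mulIf Q2); rewrite mul0r // a2 Q1 mulr0 //.
  have L0 : L = 0.
    apply/colP => a; rewrite [RHS]mxE -[a]inord_val.
    have [a3|] := ltnP a 3; first by have [] := lm0 a a3.
    by rewrite leq_eqVlt ltnNge -ltnS ltn_ord orbF => /eqP <-.
  case/negP: Qj0; have /colP/(_ (inord j0)) : sQ = 0 by rewrite -AL L0 mulmx0.
  rewrite !mxE inordK; last by apply: leq_trans (ltn_ord j0) _.
  by case: j0 => [[|[|[|//]]]] /= _ ->.
(* the third linear form is a coordinate that is nonzero at the node *)
pose p (i : nat) : k := (i == j)%:R.
have linp (f : nat -> k) : lin p (f 0%N) (f 1%N) (f 2%N) = f j.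
  case: j @p {xj} => [[|[|[|//]]]] /= _; rewrite /lin /=; cring k.
pose R (i : nat) := A (inord i) (inord j).
exists (cross l m), (nodal_cubic l m p Qf R), (fun v => quad Qf (v 0 0) (v 0 1)).
have lx : lin l (cross l m 0) (cross l m 1) (cross l m 2) = 0.
  by rewrite /lin /cross; cring k.
have mx : lin m (cross l m 0) (cross l m 1) (cross l m 2) = 0.
  by rewrite /lin /cross; cring k.
have [s1 s2 s3 s4] := nodal_cubic_sing p Qf R lx mx.
split => //; first by exists j.
- apply: nodal_cubic_neq0; first by rewrite (linp (cross l m)).
  by exists j0.
- exact: nodal_cubic_deg.
- move=> v y; rewrite nodal_cubic_eval -/(at_curve l v) -/(at_curve m v) sE tE linp.
  have -> : y j = (veronese 3 v *m col (inord j) A) 0 0.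
    by rewrite /y /row_coord !mxE; apply: eq_bigr => i _; rewrite !mxE.
  rewrite veroneseE !mxE /R /quad; cring k.
split=> // v w.
transitivity (at_curve l v * at_curve m w - at_curve l w * at_curve m v).
  by rewrite /at_curve /lin /cross; cring k.
have e (a b a' b' f g : k) : a * f * (b' * g) - a' * g * (b * f) = f * g * (a * b' - b * a').
  by cring k.
by rewrite !sE !tE e.
Qed.
End Node.

(** * Functionals supported at the singular points of a pencil *)

Section Cert.
Variable k : fieldType.
Add Ring kringPK : (rcarrier_theory k).

Section Quad.
Variables dZZ dXZ dYZ dXX dXY dYY : k.
(** Here l stands for a linear functional on the forms of degree 7, with l a b its
    value at X^a Y^b Z^(7-a-b); the condition is that it kills all the multiples
    of a given quadratic form. *)
Definition quad_rel (l : nat -> nat -> k) := forall a b, (a + b <= 5)%N ->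
  dZZ * l a b + dXZ * l a.+1 b + dYZ * l a b.+1 + dXX * l a.+2 b
  + dXY * l a.+1 b.+1 + dYY * l a b.+2 = 0.

(** A functional that kills the multiples of X^2 and of Y^2 Z^2 only sees the
    first-order neighbourhoods of the vertices (0:0:1) and (0:1:0).  A quadratic form
    that is nonzero at both vertices is invertible there. *)
Lemma vertex_killed (l : nat -> nat -> k) : dZZ != 0 -> dYY != 0 -> quad_rel l ->
  (forall a b, (1 < a)%N -> (a + b <= 7)%N -> l a b = 0) ->
  (forall a b, (1 < b)%N -> (a + b <= 5)%N -> l a b = 0) ->
  forall a b, (a + b <= 7)%N -> l a b = 0.
Proof.
move=> dZ dY D lX lY.
have vZ a b : (a + b <= 2)%N -> l a.+1 b = 0 -> l a b.+1 = 0 -> l a.+2 b = 0 ->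
    l a.+1 b.+1 = 0 -> l a b.+2 = 0 -> l a b = 0.
  move=> ab e1 e2 e3 e4 e5; have := D a b ltac:(lia).
  by rewrite e1 e2 e3 e4 e5 !mulr0 !addr0; move=> /eqP; rewrite mulf_eq0 (negPf dZ) => /eqP.
have vY a b : (a + b <= 5)%N -> l a b = 0 -> l a.+1 b = 0 -> l a b.+1 = 0 -> l a.+2 b = 0 ->
    l a.+1 b.+1 = 0 -> l a b.+2 = 0.
  move=> ab e1 e2 e3 e4 e5; have := D a b ab.
  by rewrite e1 e2 e3 e4 e5 !mulr0 !add0r; move=> /eqP; rewrite mulf_eq0 (negPf dY) => /eqP.
have l15 : l 1%N 5%N = 0 by apply: vY => //; first [exact: lX | exact: lY].
have l16 : l 1%N 6%N = 0 by apply: vY => //; first [exact: lX | exact: lY].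
have l06 : l 0%N 6%N = 0 by apply: vY => //; first [exact: lX | exact: lY].
have l07 : l 0%N 7%N = 0 by apply: vY => //; first [exact: lX | exact: lY].
have l11 : l 1%N 1%N = 0 by apply: vZ => //; first [exact: lX | exact: lY].
have l01 : l 0%N 1%N = 0 by apply: vZ => //; first [exact: lX | exact: lY].
have l10 : l 1%N 0%N = 0 by apply: vZ => //; first [exact: lX | exact: lY].
have l00 : l 0%N 0%N = 0 by apply: vZ => //; first [exact: lX | exact: lY].
move=> a b ab; have [a1|a1] := ltnP 1 a; first exact: lX.
have [/andP[b1 ab5]|] := boolP ((1 < b)%N && (a + b <= 5)%N); first exact: lY.
case: a a1 ab => [|[|a]] // _; case: b => [|[|[|[|[|[|[|[|b]]]]]]]] //.
all: lia.
Qed.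
End Quad.

(** If l and m were the functionals h |-> la * h x and h |-> mu * h x, these relations
    would say that the cubic la * f(X, Z) + mu * g(Y, Z) has zero derivatives in
    X, Y, Z, and value zero, at the point x. *)
Definition node_rels (f g : nat -> k) (l m : nat -> nat -> k) :=
  [/\ forall a b, (a + b <= 5)%N ->
        f 1%N * l a b + 2%:R * f 2%N * l a.+1 b + 3%:R * f 3%N * l a.+2 b = 0,
      forall a b, (a + b <= 5)%N ->
        g 1%N * m a b + 2%:R * g 2%N * m a b.+1 + 3%:R * g 3%N * m a b.+2 = 0,
      forall a b, (a + b <= 5)%N ->
        3%:R * f 0%N * l a b + 2%:R * f 1%N * l a.+1 b + f 2%N * l a.+2 b
        + (3%:R * g 0%N * m a b + 2%:R * g 1%N * m a b.+1 + g 2%N * m a b.+2) = 0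
    & forall a b, (a + b <= 4)%N ->
        f 0%N * l a b + f 1%N * l a.+1 b + f 2%N * l a.+2 b + f 3%N * l a.+3 b
        + (g 0%N * m a b + g 1%N * m a b.+1 + g 2%N * m a b.+2 + g 3%N * m a b.+3) = 0].

(** The derivatives of X^3 - Z^3 and Y^3 - Z^3 are monomials, up to the invertible
    factor 3, and the singular points of the members of the pencil are the three
    vertices of the coordinate triangle. *)
Lemma node_rels_fermat (f g : nat -> k) l m dZZ dXZ dYZ dXX dXY dYY :
  3%:R != 0 :> k ->
  f 0%N = -1 -> f 1%N = 0 -> f 2%N = 0 -> f 3%N = 1 ->
  g 0%N = -1 -> g 1%N = 0 -> g 2%N = 0 -> g 3%N = 1 ->
  dZZ != 0 -> dXX != 0 -> dYY != 0 ->
  quad_rel dZZ dXZ dYZ dXX dXY dYY l -> quad_rel dZZ dXZ dYZ dXX dXY dYY m ->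
  node_rels f g l m ->
  forall a b, (a + b <= 7)%N -> l a b = 0 /\ m a b = 0.
Proof.
move=> c3 f0 f1 f2 f3 g0 g1 g2 g3 dZ dX dY Dl Dm [].
rewrite f0 f1 f2 f3 g0 g1 g2 g3 => hX hY hZ _.
have lX a b : (1 < a)%N -> (a + b <= 7)%N -> l a b = 0.
  case: a => [|[|a]] // _ ab; have := hX a b ltac:(lia).
  by rewrite mulr0 !mul0r !add0r mulr1 => /eqP; rewrite mulf_eq0 (negPf c3) => /eqP.
have mY a b : (1 < b)%N -> (a + b <= 7)%N -> m a b = 0.
  case: b => [|[|b]] // _ ab; have := hY a b ltac:(lia).
  by rewrite mulr0 !mul0r !add0r mulr1 => /eqP; rewrite mulf_eq0 (negPf c3) => /eqP.
have lm a b : (a + b <= 5)%N -> l a b = - m a b.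
  move=> ab; have := hZ a b ab; rewrite !mulr0 !mul0r !addr0 -mulrDr => /eqP.
  rewrite mulf_eq0 mulrN1 oppr_eq0 (negPf c3) => /eqP/eqP.
  by rewrite addr_eq0 => /eqP.
have l0 : forall a b, (a + b <= 7)%N -> l a b = 0.
  apply: (vertex_killed dZ dY Dl lX) => a b b1 ab.
  by rewrite lm // mY ?oppr0 //; lia.
have m0 : forall b a, (b + a <= 7)%N -> m a b = 0.
  apply: (@vertex_killed dZZ dYZ dXZ dYY dXY dXX (fun b a => m a b)) => //.
  - move=> a b ab; rewrite -[RHS](Dm b a) ?[(b + a)%N]addnC //; cring k.
  - by move=> a b a1 ab; rewrite mY // addnC.
  by move=> b a a1 ab; apply/eqP; rewrite -oppr_eq0 -lm ?lX ?[(a + b)%N]addnC //; lia.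
by move=> a b ab; split; [exact: l0|apply: m0; rewrite addnC].
Qed.

(** In characteristic 3 the grid cannot be given by X^3 = 1.  For the
    polynomials X^3 - X and Y^3 + g2 Y^2 + g0 the derivatives are -1 and 2 g2 Y, which
    leaves only the singular points (1:0:0) and (0:1:0) at infinity.  The two
    functionals are shown to vanish on X^a Y^b Z^(7-a-b) for larger and larger
    values of a + b. *)
Lemma node_rels_char3 (f g : nat -> k) l m dZZ dXZ dYZ dXX dXY dYY :
  3%:R = 0 :> k ->
  f 0%N = 0 -> f 1%N = -1 -> f 2%N = 0 -> f 3%N = 1 ->
  g 0%N != 0 -> g 1%N = 0 -> g 2%N != 0 -> g 3%N = 1 ->
  dXX != 0 -> dYY != 0 ->
  quad_rel dZZ dXZ dYZ dXX dXY dYY l -> quad_rel dZZ dXZ dYZ dXX dXY dYY m ->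
  node_rels f g l m ->
  forall a b, (a + b <= 7)%N -> l a b = 0 /\ m a b = 0.
Proof.
move=> c3 f0 f1 f2 f3 g0 g1 g2 g3 dX dY Dl Dm [].
have c2 : 2%:R = -1 :> k.
  by apply/eqP; rewrite -subr_eq0 opprK -[1]/(1%:R) -natrD c3.
rewrite f0 f1 f2 f3 g1 g3 c2 c3 => hX hY hZ hC.
have cancel (d x : k) : d != 0 -> d * x = 0 -> x = 0.
  by move=> d0 /eqP; rewrite mulf_eq0 (negPf d0) => /eqP.
have l5 a b : (a + b <= 5)%N -> l a b = 0.
  move=> ab; have := hX a b ab; rewrite !mulr0 !mul0r !addr0 mulN1r => /eqP.
  by rewrite oppr_eq0 => /eqP.
have m6 a b : (0 < b)%N -> (a + b <= 6)%N -> m a b = 0.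
  case: b => // b _ ab; have := hY a b ltac:(lia).
  rewrite !mul0r addr0 add0r; apply: cancel.
  by rewrite mulN1r oppr_eq0.
have lm a b : (a + b <= 5)%N -> l a.+1 b + g 2%N * m a b.+2 = 0.
  move=> ab; rewrite -[RHS](hZ a b ab); cring k.
have hC' a b : (a + b <= 4)%N -> l a.+3 b + g 0%N * m a b + m a b.+3 = 0.
  move=> ab; rewrite -[RHS](hC a b ab) [l a.+1 b]l5 ?[m a b.+2]m6 //; try lia.
  cring k.
have m2 a b : (a + b <= 2)%N -> m a b = 0.
  move=> ab; apply: (cancel _ _ g0); rewrite -[RHS](hC' a b); last lia.
  by rewrite l5 ?[m a b.+3]m6 ?add0r ?addr0 //; lia.
have C3 a b : (a + b = 3)%N -> l a.+3 b = - (g 0%N * m a b).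
  move=> ab; have := hC' a b ltac:(lia); rewrite [m a b.+3]m6 ?addr0 //; last lia.
  by move/eqP; rewrite addr_eq0 => /eqP.
have l3 a b : (2 < a)%N -> (0 < b)%N -> (a + b = 6)%N -> l a b = 0.
  case: a => [|[|[|a]]] // _ b0 ab; rewrite C3 ?m6 ?mulr0 ?oppr0 //; lia.
have Q6 a b : (a + b = 4)%N -> dXX * l a.+2 b + dXY * l a.+1 b.+1 + dYY * l a b.+2 = 0.
  move=> ab; rewrite -[RHS](Dl a b); last lia.
  by rewrite [l a b]l5 ?[l a.+1 b]l5 ?[l a b.+1]l5 ?mulr0 ?add0r //; lia.
have YY (x y z : k) : y = 0 -> x = 0 -> dXX * x + dXY * y + dYY * z = 0 -> z = 0.
  by move=> -> ->; rewrite !mulr0 !add0r; exact: cancel.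
have XX (x y z : k) : y = 0 -> z = 0 -> dXX * x + dXY * y + dYY * z = 0 -> x = 0.
  by move=> -> ->; rewrite !mulr0 !addr0; exact: cancel.
have l24 : l 2%N 4%N = 0 by apply: YY (Q6 2%N 2%N erefl); exact: l3.
have l15 : l 1%N 5%N = 0 by apply: YY (Q6 1%N 3%N erefl) => //; exact: l3.
have l06 : l 0%N 6%N = 0 by apply: YY (Q6 0%N 4%N erefl) => //; exact: l3.
have l60 : l 6%N 0%N = 0 by apply: XX (Q6 4%N 0%N erefl) => //; exact: l3.
have l6 a b : (a + b <= 6)%N -> l a b = 0.
  rewrite leq_eqVlt => /orP[/eqP ab|]; last exact: l5.
  have [a3|a3] := ltnP 2 a; last first.
    have -> : b = (6 - a)%N by lia.
    by case: a a3 {ab} => [|[|[|]]].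
  case: b ab => [|b] ab; last exact: l3.
  by have -> : a = 6%N by lia.
have m7 a b : (1 < b)%N -> (a + b <= 7)%N -> m a b = 0.
  case: b => [|[|b]] // _ ab; apply: (cancel _ _ g2).
  by rewrite -[RHS](lm a b) ?l6 ?add0r //; lia.
have C4 a b : (a + b <= 4)%N -> l a.+3 b + g 0%N * m a b = 0.
  by move=> ab; rewrite -[RHS](hC' a b ab) [m a b.+3]m7 ?addr0 //; lia.
have l37 a b : (2 < a)%N -> (0 < b)%N -> (a + b <= 7)%N -> l a b = 0.
  case: a => [|[|[|a]]] // _ b0 ab; rewrite -[RHS](C4 a b); last lia.
  by rewrite [m a b]m6 ?mulr0 ?addr0 //; lia.
have Q7 a b : (a + b = 5)%N -> dXX * l a.+2 b + dXY * l a.+1 b.+1 + dYY * l a b.+2 = 0.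
  move=> ab; rewrite -[RHS](Dl a b); last lia.
  by rewrite [l a b]l6 ?[l a.+1 b]l6 ?[l a b.+1]l6 ?mulr0 ?add0r //; lia.
have l25 : l 2%N 5%N = 0 by apply: YY (Q7 2%N 3%N erefl); exact: l37.
have l16 : l 1%N 6%N = 0 by apply: YY (Q7 1%N 4%N erefl) => //; exact: l37.
have l07 : l 0%N 7%N = 0 by apply: YY (Q7 0%N 5%N erefl) => //; exact: l37.
have l70 : l 7%N 0%N = 0 by apply: XX (Q7 5%N 0%N erefl) => //; exact: l37.
have l7 a b : (a + b <= 7)%N -> l a b = 0.
  rewrite leq_eqVlt => /orP[/eqP ab|]; last exact: l6.
  have [a3|a3] := ltnP 2 a; last first.
    have -> : b = (7 - a)%N by lia.
    by case: a a3 {ab} => [|[|[|]]].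
  case: b ab => [|b] ab; last by apply: l37 => //; lia.
  by have -> : a = 7%N by lia.
have m4 a b : (a + b <= 4)%N -> m a b = 0.
  move=> ab; apply: (cancel _ _ g0); rewrite -[RHS](C4 a b ab) l7 ?add0r //; lia.
have QX a b : (a + b <= 5)%N -> m a b = 0 -> m a.+1 b = 0 -> m a b.+1 = 0 ->
    m a.+1 b.+1 = 0 -> m a b.+2 = 0 -> m a.+2 b = 0.
  move=> ab e1 e2 e3 e4 e5; have := Dm a b ab.
  by rewrite e1 e2 e3 e4 e5 !mulr0 !addr0 !add0r; exact: cancel.
have m50 : m 5%N 0%N = 0 by apply: QX => //; first [exact: m4|exact: m6|exact: m7].
have m60 : m 6%N 0%N = 0 by apply: QX => //; first [exact: m4|exact: m6|exact: m7].
have m61 : m 6%N 1%N = 0 by apply: QX => //; first [exact: m4|exact: m6|exact: m7].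
have m70 : m 7%N 0%N = 0 by apply: QX => //; first [exact: m4|exact: m6|exact: m7].
move=> a b ab; split; first exact: l7.
have [ab4|ab4] := leqP (a + b) 4; first exact: m4.
case: b ab ab4 => [|[|b]] ab ab4; last exact: m7.
  by move: ab ab4; rewrite !addn0; case: a => [|[|[|[|[|[|[|[|a]]]]]]]].
have [ab6|ab6] := leqP (a + 1) 6; first exact: m6.
by have -> : a = 6%N by lia.
Qed.
End Cert.

(** * Cubics through eight points of a grid *)

Section Grid.
Variable k : fieldType.
Add Ring kringPG : (rcarrier_theory k).

(** The coefficients of (X - a) (X - b) (X - c). *)
Definition cubic_coef (a b c : k) (u : nat) : k :=
  nth 0 [:: - (a * b * c); a * b + a * c + b * c; - (a + b + c); 1] u.

Lemma linear_roots (a b x y : k) : x != y -> a + b * x = 0 -> a + b * y = 0 ->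
  a = 0 /\ b = 0.
Proof.
move=> xy e1 e2; have b0 : b = 0.
  apply: (mulIf (x := x - y)); first by rewrite subr_eq0.
  transitivity ((a + b * x) - (a + b * y)); first by cring k.
  by rewrite e1 e2 subrr mul0r.
by split=> //; rewrite -[RHS]e1 b0 mul0r addr0.
Qed.

Lemma quadratic_roots (a b c x y z : k) : x != y -> x != z -> y != z ->
  a + b * x + c * x ^+ 2 = 0 -> a + b * y + c * y ^+ 2 = 0 -> a + b * z + c * z ^+ 2 = 0 ->
  [/\ a = 0, b = 0 & c = 0].
Proof.
move=> xy xz yz e1 e2 e3.
have [||d0 c0] := @linear_roots (b + c * x) c y z yz.
- apply: (mulIf (x := x - y)); first by rewrite subr_eq0.
  transitivity ((a + b * x + c * x ^+ 2) - (a + b * y + c * y ^+ 2)); first by cring k.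
  by rewrite e1 e2 subrr mul0r.
- apply: (mulIf (x := x - z)); first by rewrite subr_eq0.
  transitivity ((a + b * x + c * x ^+ 2) - (a + b * z + c * z ^+ 2)); first by cring k.
  by rewrite e1 e3 subrr mul0r.
have b0 : b = 0 by rewrite -[RHS]d0 c0 mul0r addr0.
by split=> //; rewrite -[RHS]e1 b0 c0 !mul0r !addr0.
Qed.

Variables x1 x2 x3 y1 y2 y3 : k.
Hypotheses (x12 : x1 != x2) (x13 : x1 != x3) (x23 : x2 != x3).
Hypotheses (y12 : y1 != y2) (y13 : y1 != y3) (y23 : y2 != y3).

Local Notation f := (cubic_coef x1 x2 x3).
Local Notation g := (cubic_coef y1 y2 y3).

(** The point (x3, y3) of the grid is left out: every cubic through the eight others
    contains it.  The first four points are such that the lines 14 and 23 are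
    neither horizontal nor vertical, while their abscissas have the cross-ratio 0
    and their ordinates the cross-ratio 1. *)
Definition grid_x (i : nat) : k := nth 0 [:: x1; x2; x1; x2; x1; x2; x3; x3] i.
Definition grid_y (i : nat) : k := nth 0 [:: y1; y1; y2; y3; y3; y2; y1; y2] i.

(** After subtraction of multiples of the two products, the cubic has degree at most
    two in X and in Y.  It vanishes at three points of each of the rows y1 and y2,
    and then at two points of the row y3, where it has become linear in X. *)
Lemma grid_cubics (c : nat -> nat -> k) :
  (forall u v, (3 < u + v)%N -> c u v = 0) ->
  (forall i, (i < 8)%N -> cpair c (cubic_mon 1 (grid_x i) (grid_y i)) = 0) ->
  forall u v, (u < 4)%N -> (v < 4)%N ->
    c u v = (if v == 0%N then c 3%N 0%N * f u else 0)
            + (if u == 0%N then c 0%N 3%N * g v else 0).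
Proof.
move=> cdeg cq.
pose d u v := c u v - ((if v == 0%N then c 3%N 0%N * f u else 0)
                        + (if u == 0%N then c 0%N 3%N * g v else 0)).
have ev x y : cpair c (cubic_mon 1 x y) =
    (d 0%N 0%N + d 0%N 1%N * y + d 0%N 2%N * y ^+ 2)
    + (d 1%N 0%N + d 1%N 1%N * y + d 1%N 2%N * y ^+ 2) * x
    + (d 2%N 0%N + d 2%N 1%N * y) * x ^+ 2
    + c 3%N 0%N * ((x - x1) * (x - x2) * (x - x3))
    + c 0%N 3%N * ((y - y1) * (y - y2) * (y - y3)).
  rewrite /cpair !big_ord_recr !big_ord0 /= /cubic_mon /d /cubic_coef /subn /=.
  rewrite !(cdeg 1%N 3%N isT, cdeg 2%N 2%N isT, cdeg 2%N 3%N isT, cdeg 3%N 1%N isT,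
    cdeg 3%N 2%N isT, cdeg 3%N 3%N isT).
  cring k.
have ev0 i : (i < 8)%N -> let x := grid_x i in let y := grid_y i in
    (d 0%N 0%N + d 0%N 1%N * y + d 0%N 2%N * y ^+ 2)
    + (d 1%N 0%N + d 1%N 1%N * y + d 1%N 2%N * y ^+ 2) * x
    + (d 2%N 0%N + d 2%N 1%N * y) * x ^+ 2 = 0.
  move=> i8 x y; rewrite -[RHS](cq i i8) ev -/x -/y.
  have -> : (x - x1) * (x - x2) * (x - x3) = 0.
    rewrite /x /grid_x {ev x y}.
    by case: i i8 => [|[|[|[|[|[|[|[|i]]]]]]]] /= i8; first [lia | cring k].
  have -> : (y - y1) * (y - y2) * (y - y3) = 0.
    rewrite /y /grid_y {ev x y}.
    by case: i i8 => [|[|[|[|[|[|[|[|i]]]]]]]] /= i8; first [lia | cring k].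
  by rewrite !mulr0 !addr0.
have [a1 b1 c1] := quadratic_roots x12 x13 x23 (ev0 0%N isT) (ev0 1%N isT) (ev0 6%N isT).
have [a2 b2 c2] := quadratic_roots x12 x13 x23 (ev0 2%N isT) (ev0 5%N isT) (ev0 7%N isT).
have [d20 d21] := linear_roots y12 c1 c2.
have [a3 b3] : d 0%N 0%N + d 0%N 1%N * y3 + d 0%N 2%N * y3 ^+ 2 = 0 /\
    d 1%N 0%N + d 1%N 1%N * y3 + d 1%N 2%N * y3 ^+ 2 = 0.
  apply: (linear_roots x12).
    by have := ev0 4%N isT; rewrite /= d20 d21 mul0r addr0 mul0r addr0.
  by have := ev0 3%N isT; rewrite /= d20 d21 mul0r addr0 mul0r addr0.
have [d00 d01 d02] := quadratic_roots y12 y13 y23 a1 a2 a3.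
have [d10 d11 d12] := quadratic_roots y12 y13 y23 b1 b2 b3.
have d30 : d 3%N 0%N = 0 by rewrite /d /cubic_coef /=; cring k.
have d03 : d 0%N 3%N = 0 by rewrite /d /cubic_coef /=; cring k.
move=> u v u4 v4; apply/eqP; rewrite -subr_eq0; apply/eqP; rewrite -/(d u v).
have [uv|uv] := ltnP 3 (u + v); last first.
  by move: u v u4 v4 uv => [|[|[|[|u]]]] [|[|[|[|v]]]] u4 v4 uv; first [done | lia].
rewrite /d cdeg //.
have [u0 v0] : u != 0%N /\ v != 0%N by split; apply/eqP; lia.
by rewrite (negPf u0) (negPf v0) addr0 subrr.
Qed.
End Grid.

(** * The linear relations *)

Section Rows.
Variable k : fieldType.
Add Ring kringPQ : (rcarrier_theory k).

(** Indices ((u, v), (a, b)) of the products of the coefficient of X^u Y^v in a cubic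
    with the monomial X^a Y^b Z^(7-a-b) at its node, or Z^(5-a-b) for [low_mon].
    Indices with u + v > 3 or with a + b too large are kept, and stand for 0. *)
Definition coef_mon := (('I_4 * 'I_4) * ('I_8 * 'I_8))%type.
Definition low_mon := (('I_4 * 'I_4) * ('I_6 * 'I_6))%type.
Definition rel_index :=
  (coef_mon + 'I_8 * ('I_8 * 'I_8) + 'I_4 * ('I_8 * 'I_8) + low_mon)%type.
HB.instance Definition _ := Finite.on coef_mon.
HB.instance Definition _ := Finite.on low_mon.
HB.instance Definition _ := Finite.on rel_index.

(** The coefficients of a relation that involves, for each (u, v), the single monomial
    with exponents A u v and B u v. *)
Definition row_of (F : nat -> nat -> k) (A B : nat -> nat -> nat) (t : coef_mon) : k :=
  F t.1.1 t.1.2 * ((t.2.1 == A t.1.1 t.1.2 :> nat) && (t.2.2 == B t.1.1 t.1.2 :> nat))%:R.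

Definition ext_by0 (v : coef_mon -> k) (u0 v0 a b : nat) : k :=
  if [&& (u0 < 4)%N, (v0 < 4)%N, (a < 8)%N & (b < 8)%N]
  then v ((inord u0, inord v0), (inord a, inord b)) else 0.

Lemma sum_row F A B v :
  \sum_t row_of F A B t * v t
  = cpair F (fun u0 v0 => ext_by0 v u0 v0 (A u0 v0) (B u0 v0)).
Proof.
rewrite /cpair.
transitivity (\sum_(uv : 'I_4 * 'I_4) \sum_(ab : 'I_8 * 'I_8)
    row_of F A B (uv, ab) * v (uv, ab)).
  by rewrite pair_bigA; apply: eq_bigr => -[uv ab] _.
rewrite [RHS]pair_bigA; apply: eq_bigr => -[u0 v0] _ /=.
rewrite /row_of /ext_by0 /= !inord_val !ltn_ord /=.
have [/andP[a8 b8]|nab] := ifPn.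
  rewrite (bigD1 (inord (A u0 v0), inord (B u0 v0))) //= !inordK // !eqxx mulr1.
  rewrite big1 ?addr0 // => -[a b] /=; rewrite xpair_eqE negb_and -!val_eqE /= !inordK //.
  by rewrite -negb_and => /negPf ->; rewrite mulr0 mul0r.
rewrite mulr0 big1 // => -[a b] _ /=.
case: andP => [[/eqP ea /eqP eb]|_]; last by rewrite mulr0 mul0r.
by case/negP: nab; rewrite -ea -eb !ltn_ord.
Qed.

Definition deg_x (i : nat) : nat := (i == 1%N).
Definition deg_y (i : nat) : nat := (i == 2%N).

(** The product of the linear forms l and m with a monomial of degree 5, expanded
    in the monomials of degree 7. *)
Definition quad_row (l m : nat -> k) (b : low_mon) (t : coef_mon) : k :=
  if (b.2.1 + b.2.2 <= 5)%N then
    \sum_(i < 3) \sum_(j < 3) l i * m j *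
      row_of (fun u v => ((u == b.1.1) && (v == b.1.2))%:R)
        (fun _ _ => (b.2.1 + deg_x i + deg_x j)%N) (fun _ _ => (b.2.2 + deg_y i + deg_y j)%N) t
  else 0.

Variables (xs ys : nat -> k).

Definition plane_pt (i j : nat) : k := nth 0 [:: 1; xs i; ys i] j.

Definition bad_mon (t : coef_mon) := (3 < t.1.1 + t.1.2)%N || (7 < t.2.1 + t.2.2)%N.

(** The value of the cubic at its node (s = 0) and its derivatives in X, Y, Z there,
    multiplied by the monomial with exponents a, b that brings the degree to 7. *)
Definition sing_row (s a b : nat) : coef_mon -> k :=
  match s with
  | 0 => if (a + b <= 4)%N
         then row_of (fun _ _ => 1) (fun u _ => a + u)%N (fun _ v => b + v)%N
         else fun=> 0
  | 1 => if (a + b <= 5)%N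
         then row_of (fun u _ => u%:R) (fun u _ => (a + u).-1) (fun _ v => b + v)%N
         else fun=> 0
  | 2 => if (a + b <= 5)%N
         then row_of (fun _ v => v%:R) (fun u _ => a + u)%N (fun _ v => (b + v).-1)
         else fun=> 0
  | _ => if (a + b <= 5)%N
         then row_of (fun u v => (3 - u - v)%:R) (fun u _ => a + u)%N (fun _ v => b + v)%N
         else fun=> 0
  end.

(** In order: the indices out of range contribute 0; the cubic passes through the
    eight points; it is singular at its node; the product of the equations of the
    lines 14 and 23.  The last relations are not zero at a configuration, see
    [relation_rhs]. *)
Definition relation (r : rel_index) (t : coef_mon) : k :=
  match r with
  | inl (inl (inl t0)) => if bad_mon t0 then (t == t0)%:R else 0
  | inl (inl (inr (i, (a, b)))) =>
      row_of (cubic_mon 1 (xs i) (ys i)) (fun _ _ => a : nat) (fun _ _ => b : nat) t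
  | inl (inr (s, (a, b))) => sing_row s a b t
  | inr b => quad_row (cross (plane_pt 0) (plane_pt 3)) (cross (plane_pt 1) (plane_pt 2)) b t
  end.

Lemma sum_quad_row l m (u0 v0 : 'I_4) (a b : 'I_6) v : (a + b <= 5)%N ->
  \sum_t quad_row l m ((u0, v0), (a, b)) t * v t =
  \sum_(i < 3) \sum_(j < 3)
    l i * m j * ext_by0 v u0 v0 (a + deg_x i + deg_x j) (b + deg_y i + deg_y j).
Proof.
move=> ab; rewrite /quad_row /= ab.
under eq_bigr => t _ do rewrite mulr_suml.
rewrite exchange_big; apply: eq_bigr => i _ /=.
under eq_bigr => t _ do rewrite mulr_suml.
rewrite exchange_big; apply: eq_bigr => j _ /=.
under eq_bigr => t _ do rewrite -mulrA.
rewrite -mulr_sumr sum_row; congr (_ * _).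
rewrite /cpair (bigD1 u0) //= (bigD1 v0) //= !eqxx mul1r !big1 ?addr0 // => [u1|v1] /negPf n.
  by rewrite big1 // => v1 _; rewrite -val_eqE in n; rewrite n /= mul0r.
by rewrite -val_eqE in n; rewrite n /= mul0r.
Qed.

End Rows.

(** * Triviality of the common kernel at the grid *)

Section Kernel.
Variable k : fieldType.
Add Ring kringPQ : (rcarrier_theory k).
Variables x1 x2 x3 y1 y2 y3 : k.
Hypotheses (x12 : x1 != x2) (x13 : x1 != x3) (x23 : x2 != x3).
Hypotheses (y12 : y1 != y2) (y13 : y1 != y3) (y23 : y2 != y3).

Local Notation f := (cubic_coef x1 x2 x3).
Local Notation g := (cubic_coef y1 y2 y3).
Local Notation xs := (grid_x x1 x2 x3).
Local Notation ys := (grid_y y1 y2 y3).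

Lemma cpairC (c w : nat -> nat -> k) : cpair c w = cpair w c.
Proof. by apply: eq_bigr => u _; apply: eq_bigr => v _; rewrite mulrC. Qed.

(** R applied to the coefficients of the product of the linear forms l and m. *)
Definition quad_of (l m : nat -> k) (R : k -> k -> k -> k -> k -> k -> Prop) : Prop :=
  R (l 0%N * m 0%N) (l 0%N * m 1%N + l 1%N * m 0%N) (l 0%N * m 2%N + l 2%N * m 0%N)
    (l 1%N * m 1%N) (l 1%N * m 2%N + l 2%N * m 1%N) (l 2%N * m 2%N).

(** By [grid_cubics] a vector that satisfies the relations amounts to two functionals
    la and mu on forms of degree 7; the remaining relations are then exactly
    [node_rels] and [quad_rel]. *)
Lemma relation_kernel :
  let l := cross (plane_pt xs ys 0) (plane_pt xs ys 3) in
  let m := cross (plane_pt xs ys 1) (plane_pt xs ys 2) in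
  (forall la mu, node_rels f g la mu ->
     quad_of l m (fun a b c d e h => quad_rel a b c d e h la) ->
     quad_of l m (fun a b c d e h => quad_rel a b c d e h mu) ->
     forall a b, (a + b <= 7)%N -> la a b = 0 /\ mu a b = 0) ->
  forall v : coef_mon -> k, (forall r, \sum_t relation xs ys r t * v t = 0) ->
  forall t, v t = 0.
Proof.
move=> l m cert v rv; pose w := ext_by0 v.
have bad0 t : bad_mon t -> v t = 0.
  move=> bt; rewrite -[RHS](rv (inl (inl (inl t)))) (bigD1 t) //= bt eqxx mul1r.
  by rewrite big1 ?addr0 // => t' /negPf ->; rewrite mul0r.
have wdeg a b u0 v0 : (3 < u0 + v0)%N -> w u0 v0 a b = 0.
  move=> uv; rewrite /w /ext_by0; case: ifPn => // /and4P[u4 v4 a8 b8].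
  by rewrite bad0 // /bad_mon /= !inordK // uv.
have wdeg2 u0 v0 a b : (7 < a + b)%N -> w u0 v0 a b = 0.
  move=> ab; rewrite /w /ext_by0; case: ifPn => // /and4P[u4 v4 a8 b8].
  by rewrite bad0 // /bad_mon /= !inordK // ab orbT.
(* the coefficients of X^3 and Y^3 determine a member of the pencil *)
pose la := w 3%N 0%N; pose mu := w 0%N 3%N.
have wE u0 v0 a b : (u0 < 4)%N -> (v0 < 4)%N -> w u0 v0 a b =
    (if v0 == 0%N then la a b * f u0 else 0) + (if u0 == 0%N then mu a b * g v0 else 0).
  apply: (@grid_cubics _ _ _ _ _ _ _ x12 x13 x23 y12 y13 y23 (fun u v => w u v a b)).
    exact: wdeg.
  move=> i i8; rewrite cpairC; have [ab|ab] := boolP ((a < 8)%N && (b < 8)%N).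
    have /andP[a8 b8] := ab.
    have := rv (inl (inl (inr (Ordinal i8, (Ordinal a8, Ordinal b8))))).
    by rewrite /= sum_row.
  rewrite /cpair big1 // => u0' _; rewrite big1 // => v0' _.
  by rewrite /w /ext_by0 (negPf ab) !andbF mulr0.
have pairE wt A B : cpair wt (fun u0 v0 => w u0 v0 (A u0 v0) (B u0 v0)) =
   wt 0%N 0%N * (la (A 0%N 0%N) (B 0%N 0%N) * f 0%N + mu (A 0%N 0%N) (B 0%N 0%N) * g 0%N)
   + wt 1%N 0%N * (la (A 1%N 0%N) (B 1%N 0%N) * f 1%N)
   + wt 2%N 0%N * (la (A 2%N 0%N) (B 2%N 0%N) * f 2%N)
   + wt 3%N 0%N * (la (A 3%N 0%N) (B 3%N 0%N) * f 3%N)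
   + wt 0%N 1%N * (mu (A 0%N 1%N) (B 0%N 1%N) * g 1%N)
   + wt 0%N 2%N * (mu (A 0%N 2%N) (B 0%N 2%N) * g 2%N)
   + wt 0%N 3%N * (mu (A 0%N 3%N) (B 0%N 3%N) * g 3%N).
  transitivity (cpair wt (fun u0 v0 => 
       (if v0 == 0%N :> nat then la (A u0 v0) (B u0 v0) * f u0 else 0)
       + (if u0 == 0%N :> nat then mu (A u0 v0) (B u0 v0) * g v0 else 0))).
    by apply: eq_bigr => u0 _; apply: eq_bigr => v0 _; rewrite wE.
  rewrite /cpair !big_ord_recr !big_ord0 /=; cring k.
have sing s a b : (s < 4)%N -> (a + b <= 5)%N -> \sum_t sing_row k s a b t * v t = 0.
  move=> s4 ab; have a8 : (a < 8)%N by lia. have b8 : (b < 8)%N by lia.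
  exact: (rv (inl (inr (Ordinal s4, (Ordinal a8, Ordinal b8))))).
have nr : node_rels f g la mu.
  split=> a b ab.
  - have := sing 1%N a b isT ab; rewrite /= ab sum_row pairE.
    rewrite !addn0 !addn1 !addn2 !addn3 /= => e; rewrite -[RHS]e; cring k.
  - have := sing 2%N a b isT ab; rewrite /= ab sum_row pairE.
    rewrite !addn0 !addn1 !addn2 !addn3 /= => e; rewrite -[RHS]e; cring k.
  - have := sing 3%N a b isT ab; rewrite /= ab sum_row pairE.
    rewrite !addn0 !addn1 !addn2 !addn3 /subn /= => e; rewrite -[RHS]e; cring k.
  - have := sing 0%N a b isT ltac:(lia); rewrite /= ab sum_row pairE.
    rewrite !addn0 !addn1 !addn2 !addn3 /= => e; rewrite -[RHS]e; cring k.
have quad (u0 v0 : 'I_4) a b : (a + b <= 5)%N ->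
   \sum_(i < 3) \sum_(j < 3)
     l i * m j * w u0 v0 (a + deg_x i + deg_x j)%N (b + deg_y i + deg_y j)%N = 0.
  move=> ab; have a6 : (a < 6)%N by lia. have b6 : (b < 6)%N by lia.
  by rewrite -[RHS](rv (inr ((u0, v0), (Ordinal a6, Ordinal b6)))) sum_quad_row.
have key := cert la mu nr.
have lm0 a b : (a + b <= 7)%N -> la a b = 0 /\ mu a b = 0.
  apply: key => {}a {}b ab.
    have := quad (@Ordinal 4 3 isT) (@Ordinal 4 0 isT) a b ab.
    rewrite !big_ord_recr !big_ord0 /= /deg_x /deg_y /= ?(addn0, addnS) -/la => e.
    rewrite -[RHS]e; cring k.
  have := quad (@Ordinal 4 0 isT) (@Ordinal 4 3 isT) a b ab.
  rewrite !big_ord_recr !big_ord0 /= /deg_x /deg_y /= ?(addn0, addnS) -/mu => e.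
  rewrite -[RHS]e; cring k.
move=> [[u0 v0] [a b]].
have : w u0 v0 a b = 0.
  have [ab|] := leqP (a + b) 7; last exact: wdeg2.
  by rewrite wE ?ltn_ord // (lm0 a b ab).1 (lm0 a b ab).2 !mul0r !if_same addr0.
by rewrite /w /ext_by0 !ltn_ord /= !inord_val.
Qed.
End Kernel.

(** * The relations at a nodal cubic *)

Section Pointwise.
Variable k : fieldType.
Add Ring kringPP : (rcarrier_theory k).

(** Up to the value of the two lines at the node, a relation of the last kind has
    the entry b of [yvec] as its right-hand side; the others are homogeneous. *)
Definition relation_rhs (r : rel_index) (b : low_mon) : k :=
  if r is inr b' then (b' == b)%:R else 0.

Variables (xs ys : nat -> k) (x : nat -> k) (c : nat -> nat -> k).
Hypothesis cdeg : forall u v, (3 < u + v)%N -> c u v = 0.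
Local Notation at_node w := (cpair c (w (x 0%N) (x 1%N) (x 2%N))).
Hypotheses (cq : forall i, (i < 8)%N -> cpair c (cubic_mon 1 (xs i) (ys i)) = 0).
Hypotheses (c0 : at_node (@cubic_mon k) = 0) (cX : at_node (@cubic_monX k) = 0)
  (cY : at_node (@cubic_monY k) = 0) (cZ : at_node (@cubic_monZ k) = 0).

Definition node_mono d a b : k := x 1%N ^+ a * x 2%N ^+ b * x 0%N ^+ (d - a - b).

Definition evec (t : coef_mon) : k :=
  if (t.2.1 + t.2.2 <= 7)%N then c t.1.1 t.1.2 * node_mono 7 t.2.1 t.2.2 else 0.
Definition yvec (t : low_mon) : k :=
  if (t.2.1 + t.2.2 <= 5)%N then c t.1.1 t.1.2 * node_mono 5 t.2.1 t.2.2 else 0.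

Lemma evec_neq0 : (exists u v : 'I_4, c u v != 0) -> (exists j : 'I_3, x j != 0) ->
  exists t, evec t != 0.
Proof.
move=> [u [v cuv]] [j xj].
case: j xj => [[|[|[|j]]]] j3 xj; last by lia.
- exists ((u, v), (inord 0, inord 0)); rewrite /evec /= !inordK //= /node_mono /= !expr0 !mul1r.
  by rewrite mulf_neq0 // expf_neq0.
- exists ((u, v), (inord 7, inord 0)); rewrite /evec /= !inordK //= /node_mono /= !expr0 !mulr1.
  by rewrite mulf_neq0 // expf_neq0.
- exists ((u, v), (inord 0, inord 7)).
  rewrite /evec /= !inordK //= /node_mono /= !expr0 mul1r mulr1.
  by rewrite mulf_neq0 // expf_neq0.
Qed.

Lemma ext_by0_evec u v a b : (u < 4)%N -> (v < 4)%N -> (a + b <= 7)%N ->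
  ext_by0 evec u v a b = c u v * node_mono 7 a b.
Proof.
move=> u4 v4 ab; have a8 : (a < 8)%N by lia. have b8 : (b < 8)%N by lia.
by rewrite /ext_by0 u4 v4 a8 b8 /evec /= !inordK // ab.
Qed.

Lemma mono_shift d a b i : (a + b <= d)%N -> (i < 3)%N ->
  node_mono d.+1 (a + deg_x i) (b + deg_y i) = node_mono d a b * x i.
Proof.
move=> ab; case: i => [|[|[|i]]] i3; last (by lia); rewrite /node_mono /deg_x /deg_y /=.
- rewrite !addn0 -!subnDA subSn // exprS; cring k.
- rewrite addn0 addn1 -!subnDA (_ : d.+1 - (a.+1 + b) = d - (a + b))%N; last by lia.
  rewrite exprS; cring k.
- rewrite addn0 addn1 -!subnDA (_ : d.+1 - (a + b.+1) = d - (a + b))%N; last by lia.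
  rewrite exprS; cring k.
Qed.

Lemma quad_row_evec (l m : nat -> k) b :
  \sum_t quad_row l m b t * evec t =
  lin l (x 0%N) (x 1%N) (x 2%N) * lin m (x 0%N) (x 1%N) (x 2%N) * yvec b.
Proof.
case: b => -[u v] [a b]; rewrite /yvec /=; case: ifPn => ab; last first.
  by rewrite mulr0 big1 // => t _; rewrite /quad_row /= (negPf ab) mul0r.
rewrite sum_quad_row //.
have linE (h : nat -> k) : lin h (x 0%N) (x 1%N) (x 2%N) = \sum_(i < 3) h i * x i.
  by rewrite !big_ord_recr big_ord0 /= add0r.
rewrite !linE !mulr_suml; apply: eq_bigr => i _.
rewrite mulr_sumr mulr_suml; apply: eq_bigr => j _.
rewrite ext_by0_evec //; last first.
  by rewrite /deg_x /deg_y; lia.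
rewrite mono_shift ?mono_shift //; first by cring k.
by rewrite /deg_x /deg_y; lia.
Qed.

Lemma sing_row_evec s a b : \sum_t sing_row k s a b t * evec t = 0.
Proof.
have pairE wt wt' A B d : (a + b <= d)%N ->
    (forall u v, (u + v <= 3)%N -> wt u v != 0 ->
       (A u v + B u v <= 7)%N /\
       node_mono 7 (A u v) (B u v) * wt u v = node_mono d a b * wt' u v) ->
    (forall u v, wt u v = 0 -> wt' u v = 0) ->
    cpair wt (fun u v => ext_by0 evec u v (A u v) (B u v)) = node_mono d a b * cpair c wt'.
  move=> ab H H0; rewrite /cpair mulr_sumr; apply: eq_bigr => u _.
  rewrite mulr_sumr; apply: eq_bigr => v _.
  have [z|nz] := eqVneq (wt u v) 0; first by rewrite z (H0 _ _ z) mul0r !mulr0.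
  have [uv|uv] := leqP (u + v) 3.
    have [AB e] := H u v uv nz.
    by rewrite ext_by0_evec // mulrC -mulrA e mulrCA.
  rewrite (cdeg uv) mul0r mulr0 /ext_by0.
  case: ifPn => [/and4P[u4 v4 A8 B8]|_]; last by rewrite mulr0.
  by rewrite /evec /= !inordK // cdeg // mul0r if_same mulr0.
have monoD d1 d2 a1 a2 b1 b2 : (a1 + b1 <= d1)%N -> (a2 + b2 <= d2)%N ->
    node_mono (d1 + d2) (a1 + a2) (b1 + b2) = node_mono d1 a1 b1 * node_mono d2 a2 b2.
  move=> h1 h2; rewrite /node_mono.
  have -> : (d1 + d2 - (a1 + a2) - (b1 + b2) = (d1 - a1 - b1) + (d2 - a2 - b2))%N by lia.
  rewrite !exprD.
  by rewrite [X in X * _ = _]mulrACA [LHS]mulrACA.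
rewrite /sing_row; case: s => [|[|[|s]]].
- case: ifPn => ab; last by rewrite big1 // => t _; rewrite mul0r.
  rewrite sum_row (pairE _ (cubic_mon (x 0%N) (x 1%N) (x 2%N)) _ _ 4%N) ?c0 ?mulr0 //.
    move=> u v uv _; split; first lia.
    by rewrite mulr1 -[7%N]/(4 + 3)%N monoD.
  by move=> u v /eqP; rewrite oner_eq0.
- case: ifPn => ab; last by rewrite big1 // => t _; rewrite mul0r.
  rewrite sum_row (pairE _ (cubic_monX (x 0%N) (x 1%N) (x 2%N)) _ _ 5%N) ?cX ?mulr0 //.
    move=> [|u] v uv; first by rewrite eqxx.
    move=> _; split; first lia.
    have -> : ((a + u.+1).-1 = a + u)%N by lia.
    have uv2 : (u + v <= 2)%N by lia.
    rewrite -[7%N]/(5 + 2)%N monoD //.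
    by rewrite -mulrA [_ * u.+1%:R]mulrC /cubic_monX /node_mono subSS.
  by move=> u v; rewrite /cubic_monX => ->; rewrite mul0r.
- case: ifPn => ab; last by rewrite big1 // => t _; rewrite mul0r.
  rewrite sum_row (pairE _ (cubic_monY (x 0%N) (x 1%N) (x 2%N)) _ _ 5%N) ?cY ?mulr0 //.
    move=> u [|v] uv; first by rewrite eqxx.
    move=> _; split; first lia.
    have -> : ((b + v.+1).-1 = b + v)%N by lia.
    have uv2 : (u + v <= 2)%N by lia.
    rewrite -[7%N]/(5 + 2)%N monoD //.
    rewrite -mulrA [_ * v.+1%:R]mulrC /cubic_monY /node_mono /=.
    by have -> : (3 - u - v.+1 = 2 - u - v)%N by lia.
  by move=> u v; rewrite /cubic_monY => ->; rewrite mul0r.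
case: ifPn => ab; last by rewrite big1 // => t _; rewrite mul0r.
rewrite sum_row (pairE _ (cubic_monZ (x 0%N) (x 1%N) (x 2%N)) _ _ 5%N) ?cZ ?mulr0 //.
  move=> u v uv nz; have uv2 : (u + v <= 2)%N.
    by rewrite leqNgt; apply: contraNN nz => uv2; have -> : (3 - u - v = 0)%N by lia.
  split; first lia.
  rewrite -[7%N]/(5 + 2)%N monoD // -mulrA [_ * (3 - u - v)%:R]mulrC /cubic_monZ /node_mono.
  by have -> : ((3 - u - v).-1 = 2 - u - v)%N by lia.
by move=> u v; rewrite /cubic_monZ => ->; rewrite mul0r.
Qed.

Lemma relation_evec r : \sum_t relation xs ys r t * evec t =
  lin (cross (plane_pt xs ys 0) (plane_pt xs ys 3)) (x 0%N) (x 1%N) (x 2%N)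
  * lin (cross (plane_pt xs ys 1) (plane_pt xs ys 2)) (x 0%N) (x 1%N) (x 2%N)
  * \sum_b relation_rhs r b * yvec b.
Proof.
case: r => [[[t0|[i [a b]]]|[s [a b]]]|b0].
- rewrite [X in _ = _ * X]big1 ?mulr0; last by move=> b _; rewrite /= mul0r.
  rewrite big1 // => t _ /=; case: ifPn => [|_]; last by rewrite mul0r.
  have [<-|_] := eqVneq t t0; last by rewrite mul0r.
  rewrite /bad_mon /evec => /orP[uv|ab]; first by rewrite cdeg // mul0r if_same mulr0.
  by rewrite leqNgt ab mulr0.
- rewrite [X in _ = _ * X]big1 ?mulr0; last by move=> b' _; rewrite /= mul0r.
  rewrite /= sum_row; have [ab|ab] := leqP (a + b) 7.
    transitivity (node_mono 7 a b * cpair c (cubic_mon 1 (xs i) (ys i))); last first.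
      by rewrite cq ?mulr0.
    rewrite /cpair mulr_sumr; apply: eq_bigr => u _; rewrite mulr_sumr; apply: eq_bigr => v _.
    by rewrite ext_by0_evec //; cring k.
  rewrite /cpair big1 // => u _; rewrite big1 // => v _.
  by rewrite /ext_by0; case: ifPn => _; rewrite ?mulr0 // /evec /= !inord_val leqNgt ab /= mulr0.
- rewrite [X in _ = _ * X]big1 ?mulr0; last by move=> b' _; rewrite /= mul0r.
  exact: sing_row_evec.
rewrite /= quad_row_evec; congr (_ * _).
rewrite (bigD1 b0) //= eqxx mul1r big1 ?addr0 // => b /negPf n.
by rewrite eq_sym n mul0r.
Qed.

End Pointwise.

(** * Twisted cubics that tend to three concurrent lines *)

Section Points.
Variable k : closedFieldType.
Add Ring kringPC : (rcarrier_theory k).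

Lemma line_dim m (v : 'rV[k]_m.+1) : v != 0 -> \dim <[v]>%VS == 1%N.
Proof. by move=> v0; rewrite dim_vline v0. Qed.

Lemma vline_scale m (v : 'rV[k]_m) c : c != 0 -> <[c *: v]>%VS = <[v]>%VS.
Proof.
move=> c0; apply/eqP; rewrite eqEsubv -!memvE memvZ ?memv_line //=.
by rewrite -[v in v \in _](scalerK c0) memvZ ?memv_line.
Qed.

Lemma affine_neq0 m (v : 'rV[k]_m.+1) : v 0 0 = 1 -> v != 0.
Proof.
move=> v1; apply/eqP => v0; move: v1.
by rewrite v0 mxE => /eqP; rewrite eq_sym oner_eq0.
Qed.

Definition line_pt m (v : 'rV[k]_m.+1) (v1 : v 0 0 = 1) : projspace k m :=
  exist _ <[v]>%VS (line_dim (affine_neq0 v1)).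

Lemma aff_line n m (p : 'I_n -> projspace k m) i (v : 'rV[k]_m.+1) j :
  v 0 0 = 1 -> val (p i) = <[v]>%VS -> aff i j p = v 0 j.
Proof.
move=> v1 pv; have [c c0 hc] := hcoord_line (affine_neq0 v1) pv.
by rewrite /aff hc !mxE v1 mulr1 mulrC mulKf.
Qed.

Lemma hcoord_line0 m (p : projspace k m) (v : 'rV[k]_m.+1) :
  v 0 0 = 1 -> val p = <[v]>%VS -> hcoord p 0 0 != 0.
Proof.
move=> v1 pv; have [c c0 hc] := hcoord_line (affine_neq0 v1) pv.
by rewrite hc mxE v1 mulr1.
Qed.

(** The twisted cubic of the points (1, t, f t / e, e * t^2) tends to the three
    concurrent lines f X = 0 of the plane W = 0.  If f xq = 0, its point of parameter
    xq + e * u tends to (1, xq, f' xq * u 0, 0), and u 0 is chosen so as to reach the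
    ordinate yq.  The boolean sw exchanges the roles of X and Y. *)
Section NodalArc.
Variables (n : nat) (f0 f1 f2 : k) (xq yq : 'I_n -> k) (sw : bool).
Let df x := 3%:R * x ^+ 2 + 2%:R * f2 * x + f1.
Hypotheses (fx : forall i, xq i ^+ 3 + f2 * xq i ^+ 2 + f1 * xq i + f0 = 0)
  (dfx : forall i, df (xq i) != 0).

(* the powers of 'X keep the parameters distinct even for points with one limit *)
Let u i : {poly k} := (yq i / df (xq i))%:P + 'X ^+ i.+1.
Definition arc_t i : {poly k} := (xq i)%:P + 'X * u i.
(** The polynomial (f \Po arc_t i) / 'X, by Taylor's formula at xq i. *)
Definition arc_y i : {poly k} := u i * ((df (xq i))%:P
   + 'X * u i * (3%:R * xq i + f2)%:P + ('X * u i) ^+ 2).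

Definition nodal_arc i : 'rV[{poly k}]_4 := \row_j nth 0
  (if sw then [:: 1; arc_y i; arc_t i; 'X * arc_t i ^+ 2]
   else [:: 1; arc_t i; arc_y i; 'X * arc_t i ^+ 2]) j.

Definition arc_bad : {poly k} := 'X * \prod_i \prod_(j | j != i) (arc_t i - arc_t j).

Local Notation vat e i := (map_mx (horner_eval e) (nodal_arc i)).

Lemma arc_vat1 e i : vat e i 0 0 = 1.
Proof. by rewrite !mxE /=; case: sw; rewrite /= /horner_eval hornerE. Qed.

Definition arc_pt e : 'I_n -> projspace k 3 := fun i => line_pt (arc_vat1 e i).

(** The entry (l, j) is the coefficient of t^l in the coordinate j. *)
Definition arc_mx e (l j : nat) : k :=
  nth 0 (nth [::] (if sw then
    [:: [:: 1; f0 / e; 0; 0];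
        [:: 0; f1 / e; 1; 0];
        [:: 0; f2 / e; 0; e];
        [:: 0; 1 / e; 0; 0]]
  else
    [:: [:: 1; 0; f0 / e; 0];
        [:: 0; 1; f1 / e; 0];
        [:: 0; 0; f2 / e; e];
        [:: 0; 0; 1 / e; 0]]) l) j.

Lemma arc_mx_unit e : e != 0 -> \matrix_(l < 4, j < 4) arc_mx e l j \in unitmx.
Proof.
move=> e0; rewrite unitmxE unitfE (det_nat4 (arc_mx e)) /arc_mx.
have ee : 1 / e * e = 1 by rewrite div1r mulVf.
case: sw => /=.
  set d := (X in X != 0); have -> : d = 1 / e * e by rewrite /d; cring k.
  by rewrite ee oner_neq0.
set d := (X in X != 0); have -> : d = - (1 / e * e) by rewrite /d; cring k.
by rewrite ee oppr_eq0 oner_neq0.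
Qed.

Definition arc_v e i : 'rV[k]_2 := \row_a nth 0 [:: 1; (arc_t i).[e]] a.

Lemma arc_y_eq e i : e * (arc_y i).[e] =
  (arc_t i).[e] ^+ 3 + f2 * (arc_t i).[e] ^+ 2 + f1 * (arc_t i).[e] + f0.
Proof.
rewrite /arc_y /arc_t !(hornerE, horner_exp) /=.
rewrite -[LHS]addr0 -[X in _ + X](fx i) /df; set w := (u i).[e].
cring k.
Qed.

Lemma arc_vat e i : e != 0 ->
  vat e i = veronese 3 (arc_v e i) *m (\matrix_(l < 4, j < 4) arc_mx e l j).
Proof.
move=> e0; apply/rowP => j; rewrite !mxE sum_ord4 !mxE !inordK //= /horner_eval.
rewrite ?expr1n ?mul1r ?expr0.
have yE : (arc_y i).[e] =
    ((arc_t i).[e] ^+ 3 + f2 * (arc_t i).[e] ^+ 2 + f1 * (arc_t i).[e] + f0) / e.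
  by rewrite -arc_y_eq mulrC mulKf.
have wE : ('X * arc_t i ^+ 2).[e] = e * (arc_t i).[e] ^+ 2.
  by rewrite hornerM hornerX horner_exp.
rewrite /arc_mx.
case: sw; case: j => [[|[|[|[|j]]]] j4]; try lia; rewrite /= ?yE ?wE ?hornerC.
all: by rewrite -[LHS]addr0; cring k.
Qed.

Lemma arc_t_inj i j : arc_t i = arc_t j -> i = j.
Proof.
move=> /(congr1 (fun p : {poly k} => p`_i.+2)).
rewrite /arc_t /u !coefD !coefC !coefXM /= !coefD !coefC !coefXn /= !add0r !eqSS eqxx.
by case: eqP => [/val_inj|_ /eqP] //; rewrite oner_eq0.
Qed.

Lemma arc_bad_neq0 : arc_bad != 0.
Proof.
rewrite mulf_neq0 ?polyX_eq0 //; apply/prodf_neq0 => i _; apply/prodf_neq0 => j ji.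
by rewrite subr_eq0; apply: contraNneq ji => /arc_t_inj ->.
Qed.

Lemma arc_badP e : arc_bad.[e] != 0 ->
  e != 0 /\ forall i j, i != j -> (arc_t i).[e] != (arc_t j).[e].
Proof.
rewrite hornerM hornerX mulf_eq0 negb_or horner_prod => /andP[e0 H]; split=> // i j ij.
move/prodf_neq0: H => /(_ i isT); rewrite horner_prod => /prodf_neq0/(_ j).
by rewrite eq_sym ij => /(_ isT); rewrite !hornerE subr_eq0.
Qed.

Lemma arc_vat0 i : vat 0 i = \row_j nth 0
  (if sw then [:: 1; yq i; xq i; 0] else [:: 1; xq i; yq i; 0]) j.
Proof.
apply/rowP => j; rewrite !mxE /horner_eval.
have tE : (arc_t i).[0] = xq i by rewrite /arc_t !hornerE.
have yE : (arc_y i).[0] = yq i.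
  have uE : (u i).[0] = yq i / df (xq i).
    by rewrite /u hornerD hornerC hornerXn expr0n addr0.
  have zE : ('X * u i).[0] = 0 by rewrite hornerM hornerX mul0r.
  rewrite /arc_y hornerM uE; move: ('X * u i) zE => Z zE.
  by rewrite !hornerD hornerC hornerM horner_exp zE mul0r expr0n !addr0 divfK.
by case: sw; case: j => [[|[|[|[|j]]]] j4]; try lia; rewrite /= ?tE ?yE ?hornerE.
Qed.

Lemma arc_aff e i j : aff i j (arc_pt e) = vat e i 0 j.
Proof. exact: aff_line (arc_vat1 e i) _. Qed.

Lemma arc_locus e : arc_bad.[e] != 0 -> @veronese_locus k 3 n (arc_pt e).
Proof.
move=> /arc_badP[e0 tinj]; split.
  move=> i j pij; apply/eqP; apply: contraT => ij; have := tinj i j ij.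
  have tE l : (arc_t l).[e] = aff l (if sw then 2%:R else 1) (arc_pt e).
    by rewrite arc_aff !mxE; case: sw.
  by rewrite !tE /aff pij eqxx.
exists [set p | exists q : projspace k 1, val p =
   <[veronese 3 (hcoord q) *m \matrix_(l < 4, j < 4) arc_mx e l j]>%VS].
  by exists (\matrix_(l < 4, j < 4) arc_mx e l j) => //; exact: arc_mx_unit.
move=> i /=; have v1 : arc_v e i 0 0 = 1 by rewrite mxE.
exists (line_pt v1); have [c c0 ->] := hcoord_line (affine_neq0 v1) (erefl (val (line_pt v1))).
have -> : veronese 3 (c *: arc_v e i) = c ^+ 3 *: veronese 3 (arc_v e i).
  apply/rowP => j; rewrite !mxE !exprMn mulrACA -exprD.
  by rewrite subnK // -ltnS ltn_ord.
rewrite -scalemxAl -arc_vat //.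
by rewrite vline_scale // expf_neq0.
Qed.

End NodalArc.
End Points.

(** * The cross-ratio as a rational function *)

Section Locus.
Variables (k : closedFieldType) (n : nat).
Add Ring kringPU : (rcarrier_theory k).
Local Notation X := ('I_n -> projspace k 3).

Lemma locus_aff (p : X) : @veronese_locus k 3 n p ->
  exists (A : 'M[k]_4) (v : 'I_n -> 'rV[k]_2) (s : 'I_n -> k), A \in unitmx /\
    forall i j, aff i j p = s i * (veronese 3 (v i) *m A) 0 j.
Proof.
move=> [_ [C [A uA ->] pC]]; have /choice[q hq] := pC.
pose v i := hcoord (q i); pose w i := veronese 3 (v i) *m A.
have /choice[c hc] : forall i, exists c, hcoord (p i) = c *: w i.
  move=> i; have w0 : w i != 0.
    by have /eqP := valP (p i); rewrite hq dim_vline -/(w i); case: eqP.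
  by have [c _ hc] := hcoord_line w0 (hq i); exists c.
exists A, v, (fun i => c i / hcoord (p i) 0 0); split=> // i j.
have hcj : hcoord (p i) 0 j = c i * w i 0 j by rewrite hc mxE.
by rewrite /aff hcj mulrAC.
Qed.

Variable ix : nat -> 'I_n.

Definition bracket (i1 i2 i3 i4 : nat) (p : X) : k :=
  \det (\matrix_(a < 4, b < 4) aff (ix (nth 0 [:: i1; i2; i3; i4] a)%N) b p).

(** The quotient is the cross-ratio of the parameters of the points 0, 1, 2, 3 on any
    twisted cubic; the points 4 and 5 are auxiliary, since a determinant of four
    points of the curve is a product of differences of parameters. *)
Definition cr_num p := bracket 0 2 4 5 p * bracket 1 3 4 5 p.
Definition cr_den p := bracket 0 3 4 5 p * bracket 1 2 4 5 p.

Section Eval.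
Variables (p : X) (A : 'M[k]_4) (v : 'I_n -> 'rV[k]_2) (s : 'I_n -> k).
Hypothesis affE : forall i j, aff i j p = s i * (veronese 3 (v i) *m A) 0 j.

Definition vwedge i j : k := wedge (fun i => v (ix i) 0 0) (fun i => v (ix i) 0 1) i j.

Lemma bracket_eval i1 i2 i3 i4 : bracket i1 i2 i3 i4 p =
  s (ix i1) * s (ix i2) * s (ix i3) * s (ix i4) *
  (vwedge i1 i2 * vwedge i1 i3 * vwedge i1 i4 * vwedge i2 i3 * vwedge i2 i4 * vwedge i3 i4)
  * \det A.
Proof.
pose I a := ix (nth 0 [:: i1; i2; i3; i4] a)%N.
pose M : 'M[k]_4 := \matrix_(a < 4, b < 4)
  (s (I a) * (v (I a) 0 0 ^+ (3 - b) * v (I a) 0 1 ^+ b)).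
have -> : bracket i1 i2 i3 i4 p = \det (M *m A).
  congr (\det _); apply/matrixP => a b; rewrite !mxE affE !mxE mulr_sumr.
  by apply: eq_bigr => l _; rewrite !mxE -!mulrA.
by rewrite det_mulmx
  (det_homog_vandermonde (fun a => s (I a)) (fun a => v (I a) 0 0) (fun a => v (I a) 0 1)).
Qed.

Lemma cross_ratio_eval :
  cr_num p * (vwedge 0 3 * vwedge 1 2) = cr_den p * (vwedge 0 2 * vwedge 1 3).
Proof. rewrite /cr_num /cr_den !bracket_eval; cring k. Qed.

Lemma cr_den_neq0 : A \in unitmx -> (forall i, s (ix i) != 0) ->
  (forall i j, (i < j)%N -> (j < 8)%N -> vwedge i j != 0) -> cr_den p != 0.
Proof.
rewrite unitmxE unitfE => dA s0 w0.
by rewrite /cr_den !bracket_eval !mulf_neq0 ?s0 ?w0.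
Qed.
End Eval.

Definition chart_x (p : X) (i : nat) : k := aff (ix i) 1 p.
Definition chart_y (p : X) (i : nat) : k := aff (ix i) 2%:R p.

Local Notation chart_pt p := (plane_pt (chart_x p) (chart_y p)).

Lemma lin_cross_scale (f g f' g' : nat -> k) a b z x y :
  (forall j, (j < 3)%N -> f j = a * f' j) -> (forall j, (j < 3)%N -> g j = b * g' j) ->
  lin (cross f g) z x y = a * b * lin (cross f' g') z x y.
Proof.
move=> hf hg; rewrite /lin /cross !hf // !hg //; cring k.
Qed.

Lemma cpair_scale (c : nat -> nat -> k) a z x y :
  (forall u v, (3 < u + v)%N -> c u v = 0) ->
  cpair c (cubic_mon (a * z) (a * x) (a * y)) = a ^+ 3 * cpair c (cubic_mon z x y).
Proof.
move=> cdeg; rewrite /cpair mulr_sumr; apply: eq_bigr => u _.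
rewrite mulr_sumr; apply: eq_bigr => v _.
have [uv|uv] := leqP (u + v) 3; last by rewrite cdeg // !mul0r mulr0.
rewrite [RHS]mulrCA /cubic_mon !exprMn; congr (_ * _).
have -> : a ^+ 3 = a ^+ u * a ^+ v * a ^+ (3 - u - v) by rewrite -!exprD; congr (_ ^+ _); lia.
by rewrite [X in X * _ = _]mulrACA [LHS]mulrACA.
Qed.

(** The data needed by [elimination] at a configuration on a twisted cubic: e and y
    are the products of a coefficient of the nodal cubic with a monomial at the
    node, dl = [x14][x23] and gm = [x13][x24] for points numbered from 1. *)
Lemma locus_relations (p : X) : @veronese_locus k 3 n p ->
  (forall i, (i < 8)%N -> hcoord (p (ix i)) 0 0 != 0) ->
  exists (e : coef_mon -> k) (y : low_mon -> k) (dl gm : k),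
    [/\ exists t, e t != 0,
        forall r, \sum_t relation (chart_x p) (chart_y p) r t * e t
                  = dl * \sum_b relation_rhs k r b * y b,
        forall b, gm * y b = \sum_t quad_row
          (cross (chart_pt p 0) (chart_pt p 2)) (cross (chart_pt p 1) (chart_pt p 3)) b t * e t
      & cr_num p * dl = cr_den p * gm].
Proof.
move=> Up h0; have [A [v [s [uA affE]]]] := locus_aff Up.
have [x [c [q [x0 c0 cdeg cq [d0 dX dY dZ qx]]]]] := nodal_projection uA.
have aff0 i : (i < 8)%N -> aff (ix i) 0 p = 1 by move=> i8; rewrite /aff divff ?h0.
have [i0 i1 i2] : [/\ inord 0 = 0 :> 'I_4, inord 1 = 1 :> 'I_4 & inord 2 = 2%:R :> 'I_4].
  by split; apply/val_inj; rewrite /= inordK.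
have hE i j : (i < 8)%N -> (j < 3)%N ->
    chart_pt p i j = s (ix i) * row_coord (veronese 3 (v (ix i)) *m A) j.
  move=> i8; rewrite /row_coord; case: j => [|[|[|j]]] j3; last by lia.
  - by rewrite i0 /plane_pt /= -(aff0 i i8) affE.
  - by rewrite i1 /plane_pt /= /chart_x affE.
  - by rewrite i2 /plane_pt /= /chart_y affE.
have cq' i : (i < 8)%N -> cpair c (cubic_mon 1 (chart_x p i) (chart_y p i)) = 0.
  move=> i8; have /= := (hE i 0%N i8 isT, hE i 1%N i8 isT, hE i 2%N i8 isT).
  by rewrite /plane_pt /= => -[[-> ->] ->]; rewrite cpair_scale // cq mulr0.
exists (evec x c), (yvec x c); eexists; eexists; split.
- exact: evec_neq0.
- by move=> r; rewrite (relation_evec cdeg cq').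
- by move=> b; rewrite quad_row_evec.
have lE i j : (i < 8)%N -> (j < 8)%N ->
  lin (cross (chart_pt p i) (chart_pt p j)) (x 0%N) (x 1%N) (x 2%N)
  = s (ix i) * s (ix j) * (q (v (ix i)) * q (v (ix j)) * vwedge v i j).
  move=> i8 j8.
  rewrite (@lin_cross_scale _ _ _ _ _ _ _ _ _ (fun a => hE i a i8) (fun a => hE j a j8)).
  rewrite qx /vwedge /wedge; congr (_ * (_ * (_ - _))); exact: mulrC.
rewrite !lE //.
have := cross_ratio_eval affE; move: (cr_num p) (cr_den p) => N D.
set w03 := vwedge v 0 3; set w12 := vwedge v 1 2.
set w02 := vwedge v 0 2; set w13 := vwedge v 1 3.
move=> e.
set F := s (ix 0) * s (ix 1) * s (ix 2) * s (ix 3) *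
  (q (v (ix 0)) * q (v (ix 1)) * q (v (ix 2)) * q (v (ix 3))).
transitivity (F * (N * (w03 * w12))); first by rewrite /F; cring k.
by rewrite e /F; cring k.
Qed.
End Locus.

(** * The two arcs and the contradiction *)

Section RegRows.
Variables (k : closedFieldType) (n : nat) (V : set ('I_n -> projspace k 3)).
Local Notation X := ('I_n -> projspace k 3).
Variables (P : X) (VP : V P).
Local Notation reg := (regular_at V P).

Variables (xs ys : X -> nat -> k).
Hypotheses (rxs : forall i, reg (fun p => xs p i)) (rys : forall i, reg (fun p => ys p i)).
Local Notation pts p := (plane_pt (xs p) (ys p)).

Lemma reg_plane_pt i j : reg (fun p => plane_pt (xs p) (ys p) i j).
Proof.
rewrite /plane_pt; case: j => [|[|[|j]]] /=; [exact: reg_cst|exact: rxs|exact: rys|].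
have -> : (fun p : X => nth 0 [::] j) = fun=> 0 :> k by apply/funext => p; rewrite nth_nil.
exact: reg_cst.
Qed.

Lemma reg_cross i j a : reg (fun p => cross (pts p i) (pts p j) a).
Proof.
by rewrite /cross; case: a => [|[|a]]; apply: regB; apply: regM; exact: reg_plane_pt.
Qed.

Lemma reg_row_of F A B t : (forall u v, reg (fun p => F p u v)) ->
  reg (fun p => row_of (F p) A B t).
Proof. by move=> rF; rewrite /row_of; apply: regM => //; exact: reg_cst. Qed.

Lemma reg_quad_row (l m : X -> nat -> k) b t :
  (forall i, reg (fun p => l p i)) -> (forall i, reg (fun p => m p i)) ->
  reg (fun p => quad_row (l p) (m p) b t).
Proof.
move=> rl rm; case: b => -[u v] [a b]; rewrite /quad_row /=.
have [ab|ab] := boolP (a + b <= 5)%N; last exact: reg_cst.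
apply: (@reg_sum _ _ _ _ _ _ _ (fun (i : 'I_3) p => \sum_(j < 3) l p i * m p j * _)) => i.
apply: (@reg_sum _ _ _ _ _ _ _ (fun (j : 'I_3) p => l p i * m p j * _)) => j.
by apply: regM; [exact: regM|exact: reg_cst].
Qed.

Lemma reg_relation s t : reg (fun p => relation (xs p) (ys p) s t).
Proof.
case: s => [[[t0|[i [a b]]]|[s [a b]]]|b] /=.
- exact: reg_cst.
- apply: (reg_row_of (F := fun p => cubic_mon 1 (xs p i) (ys p i))) => u v.
  apply: (regM (f := fun p => xs p i ^+ u * ys p i ^+ v)); last exact: reg_cst.
  by apply: (regM (f := fun p => xs p i ^+ u)); exact: reg_exp.
- exact: reg_cst.
exact: (reg_quad_row (l := fun p => cross (pts p 0) (pts p 3))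
  (m := fun p => cross (pts p 1) (pts p 2)) b t (reg_cross 0 3) (reg_cross 1 2)).
Qed.
End RegRows.

Section Main.
Variables (k : closedFieldType) (m : nat).
Add Ring kringPF : (rcarrier_theory k).
Local Notation n := m.+4.+4.
Local Notation X := ('I_n -> projspace k 3).
Variables x1 x2 x3 y1 y2 y3 : k.
Hypotheses (x12 : x1 != x2) (x13 : x1 != x3) (x23 : x2 != x3).
Hypotheses (y12 : y1 != y2) (y13 : y1 != y3) (y23 : y2 != y3).

Local Notation f := (cubic_coef x1 x2 x3).
Local Notation g := (cubic_coef y1 y2 y3).
Local Notation xs := (grid_x x1 x2 x3).
Local Notation ys := (grid_y y1 y2 y3).
Let V := @veronese_compactification k 3 n.
Let U := @veronese_locus k 3 n.
(* the points of index 7 and more have the same limit *)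
Let ix (i : nat) : 'I_n := inord i.
Let xq (i : 'I_n) := xs (minn i 7).
Let yq (i : 'I_n) := ys (minn i 7).

Let Pv (i : 'I_n) : 'rV[k]_4 := \row_j nth 0 [:: 1; xq i; yq i; 0] j.
Let Pv1 i : Pv i 0 0 = 1. Proof. by rewrite mxE. Qed.
Let P : X := fun i => line_pt (Pv1 i).

Let ixE i : (i < 8)%N -> ix i = i :> nat.
Proof. by move=> i8; rewrite inordK //; lia. Qed.

Lemma cubic_coef_root a b c z : (z == a) || (z == b) || (z == c) ->
  z ^+ 3 + cubic_coef a b c 2 * z ^+ 2 + cubic_coef a b c 1 * z + cubic_coef a b c 0 = 0 :> k.
Proof.
by rewrite /cubic_coef /= => /orP[/orP[]|] /eqP ->; cring k.
Qed.

Lemma cubic_coef_deriv a b c z : a != b -> a != c -> b != c ->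
  (z == a) || (z == b) || (z == c) ->
  3%:R * z ^+ 2 + 2%:R * cubic_coef a b c 2 * z + cubic_coef a b c 1 != 0 :> k.
Proof.
rewrite -!(subr_eq0 _ b) -!(subr_eq0 _ c) /cubic_coef /= => ab ac bc.
set d := (X in X != 0) => /orP[/orP[]|] zE.
- have -> : d = (a - b) * (a - c); last by rewrite mulf_neq0.
  by rewrite /d; move/eqP: zE => ->; cring k.
- have -> : d = - ((a - b) * (b - c)); last by rewrite oppr_eq0 mulf_neq0.
  by rewrite /d; move: zE; rewrite subr_eq0 => /eqP ->; cring k.
have -> : d = (a - c) * (b - c); last by rewrite mulf_neq0.
by rewrite /d; move: zE; rewrite subr_eq0 => /eqP ->; cring k.
Qed.

Let UV : U `<=` V. Proof. by move=> p Up Z _ /(_ p Up). Qed.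

(** P is the limit of an arc of the locus, hence lies in V.  Along the arc the
    cross-ratio is that of the parameters of the points, which tend to the a i; a
    regular function that equals the cross-ratio near P takes the limit as its
    value at P. *)
Lemma arc_argument (f0 f1 f2 : k) (a b : 'I_n -> k) (sw : bool)
  (fx : forall i, a i ^+ 3 + f2 * a i ^+ 2 + f1 * a i + f0 = 0)
  (dfx : forall i, 3%:R * a i ^+ 2 + 2%:R * f2 * a i + f1 != 0) :
  (forall i, Pv i = \row_j nth 0 (if sw then [:: 1; b i; a i; 0] else [:: 1; a i; b i; 0]) j) ->
  [/\ V P, ~ vanishes_near V P (cr_den ix) &
     forall h, regular_at V P h ->
     vanishes_near V P (fun p => cr_num ix p - h p * cr_den ix p) ->
     h P * ((a (ix 3) - a (ix 0)) * (a (ix 2) - a (ix 1)))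
       = (a (ix 2) - a (ix 0)) * (a (ix 3) - a (ix 1))].
Proof.
move=> PvE.
pose v := nodal_arc f1 f2 a b sw; pose D := arc_bad f1 f2 a b.
pose x := arc_pt f1 f2 a b sw.
have D0 : D != 0 by exact: arc_bad_neq0.
have xv e : D.[e] != 0 -> forall i, map_mx (horner_eval e) (v i) != 0 /\
    val (x e i) = <[map_mx (horner_eval e) (v i)]>%VS.
  by move=> _ i; split=> //; apply: affine_neq0; exact: arc_vat1.
have Pe i : map_mx (horner_eval 0) (v i) != 0 /\
    val (P i) = <[map_mx (horner_eval 0) (v i)]>%VS.
  by rewrite (arc_vat0 b sw dfx) -PvE; split=> //; exact: affine_neq0.
have xU e : D.[e] != 0 -> U (x e) by move=> De; exact: (arc_locus sw fx De).
have xV e : D.[e] != 0 -> V (x e) by move=> De; exact: (UV (xU e De)).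
have VP : V P by exact: (arc_closure D0 xv Pe xU).
pose t i : {poly k} := arc_t f1 f2 a b (ix i).
have affx e i j : D.[e] != 0 -> aff i j (x e) = 1 * (veronese 3 (arc_v f1 f2 a b e i) *m
    \matrix_(l < 4, j < 4) arc_mx f0 f1 f2 sw e l j) 0 j.
  by move=> /arc_badP[e0 _]; rewrite mul1r /x arc_aff (arc_vat b sw fx).
have wE e i j : vwedge ix (arc_v f1 f2 a b e) i j = (t j).[e] - (t i).[e].
  by rewrite /vwedge /wedge !mxE /= !mul1r.
have den0 e : D.[e] != 0 -> cr_den ix (x e) != 0.
  move=> De; have [e0 tne] := arc_badP De.
  apply: (cr_den_neq0 (fun i j => affx e i j De)) => [|i|i j ij j8].
  - exact: arc_mx_unit.
  - exact: oner_neq0.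
  rewrite wE subr_eq0; apply: tne; rewrite -val_eqE /= !ixE ?gtn_eqF //; lia.
split=> //.
  move=> [W [oW WP hW]]; have [e De We] := arc_exists D0 xv Pe oW WP.
  by have /eqP := hW _ We (xV e De); rewrite (negPf (den0 e De)).
move=> h rh [W [oW WP hW]].
have t0 i : (t i).[0] = a (ix i) by rewrite /t /arc_t !hornerE.
have hB (p q : {poly k}) e : (p - q).[e] = p.[e] - q.[e] by rewrite hornerD hornerN.
suff : h P * ((t 3%N - t 0%N) * (t 2%N - t 1%N)).[0] = ((t 2%N - t 0%N) * (t 3%N - t 1%N)).[0].
  by rewrite !hornerM !hB !t0.
apply: (arc_limit D0 xv Pe VP xV rh oW WP) => e De We.
rewrite !hornerM !hB.
have := cross_ratio_eval ix (fun i j => affx e i j De).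
rewrite !wE; have /eqP := hW _ We (xV e De); rewrite subr_eq0 => /eqP ->.
rewrite -mulrA mulrCA; exact: (mulfI (den0 e De)).
Qed.

(** The cross-ratio is integral by [elimination], so normality would make it regular at
    P; the arcs that tend to the vertical lines and to the horizontal lines would
    give it the values 0 and 1 there. *)
Lemma not_normal_of_certificate :
  let l := cross (plane_pt xs ys 0) (plane_pt xs ys 3) in
  let l' := cross (plane_pt xs ys 1) (plane_pt xs ys 2) in
  (forall la mu, node_rels f g la mu ->
     quad_of l l' (fun a b c d e h => quad_rel a b c d e h la) ->
     quad_of l l' (fun a b c d e h => quad_rel a b c d e h mu) ->
     forall a b, (a + b <= 7)%N -> la a b = 0 /\ mu a b = 0) ->
  ~ normal_variety V.
Proof.
move=> l l' cert nV.
have rootx i : (xq i == x1) || (xq i == x2) || (xq i == x3).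
  rewrite /xq; move: (minn i 7) (geq_minr i 7) => j.
  by case: j => [|[|[|[|[|[|[|[|j]]]]]]]] //= _; rewrite /grid_x /= eqxx ?orbT.
have rooty i : (yq i == y1) || (yq i == y2) || (yq i == y3).
  rewrite /yq; move: (minn i 7) (geq_minr i 7) => j.
  by case: j => [|[|[|[|[|[|[|[|j]]]]]]]] //= _; rewrite /grid_y /= eqxx ?orbT.
have xqE i : (i < 8)%N -> xq (ix i) = xs i by move=> i8; rewrite /xq ixE // (minn_idPl _).
have yqE i : (i < 8)%N -> yq (ix i) = ys i by move=> i8; rewrite /yq ixE // (minn_idPl _).
have [VP hden lim1] := @arc_argument _ _ _ xq yq false
  (fun i => cubic_coef_root (rootx i))
  (fun i => cubic_coef_deriv x12 x13 x23 (rootx i)) (fun i => erefl).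
have [_ _ lim2] := @arc_argument _ _ _ yq xq true
  (fun i => cubic_coef_root (rooty i))
  (fun i => cubic_coef_deriv y12 y13 y23 (rooty i)) (fun i => erefl).
have hP i : hcoord (P i) 0 0 != 0 by exact: (@hcoord_line0 k 3 (P i) _ (Pv1 i)).
have affP i j : aff i j P = Pv i 0 j by exact: (@aff_line k n 3 P i _ j (Pv1 i)).
have rx i : regular_at V P (fun p => chart_x ix p i) by exact: reg_aff.
have ry i : regular_at V P (fun p => chart_y ix p i) by exact: reg_aff.
have rb i1 i2 i3 i4 : regular_at V P (bracket ix i1 i2 i3 i4).
  apply: (@reg_det _ _ _ _ _ _ (fun a b => aff (ix (nth 0 [:: i1; i2; i3; i4] a)%N) b)) => a b.
  exact: reg_aff.
have rnum : regular_at V P (cr_num ix) by exact: regM.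
have rden : regular_at V P (cr_den ix) by exact: regM.
pose W0 : set X := [set p | forall i, (i < 8)%N -> hcoord (p (ix i)) 0 0 != 0].
have oW0 : zariski_open W0.
  apply: (@zariski_open_forall _ _ _ (fun i => [set p | hcoord (p (ix i)) 0 0 != 0])) => i.
  have := zariski_open_neq0 (@multihomogXU k 3 n (ix i) 0).
  by congr (zariski_open _); apply/seteqP; split=> p /=; rewrite heval_coord.
have kerP : forall v : coef_mon -> k,
    (forall s, \sum_t relation (chart_x ix P) (chart_y ix P) s t * v t = 0) ->
    forall t, v t = 0.
  move=> v hv; apply: (relation_kernel x12 x13 x23 y12 y13 y23 cert) => s.
  have cx i : (i < 8)%N -> chart_x ix P i = xs i.
    by move=> i8; rewrite /chart_x affP mxE /= xqE.
  have cy i : (i < 8)%N -> chart_y ix P i = ys i.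
    by move=> i8; rewrite /chart_y affP mxE /= yqE.
  have hE i j : (i < 8)%N -> plane_pt (chart_x ix P) (chart_y ix P) i j = plane_pt xs ys i j.
    by move=> i8; rewrite /plane_pt cx // cy.
  rewrite -[RHS](hv s); apply: eq_bigr => t _; congr (_ * _).
  case: s => [[[t0|[i [a b]]]|[s [a b]]]|b] //=; first by rewrite cx // cy.
  by congr quad_row; apply/funext => j; rewrite /cross !hE.
have [d [B [rB vB]]] := elimination VP UV (@subset_refl _ V) oW0 (fun i _ => hP (ix i))
  (reg_relation rx ry)
  (fun b t => reg_quad_row b t (reg_cross rx ry 0 2) (reg_cross rx ry 1 3))
  rnum rden kerP (fun p W0p Up => locus_relations Up W0p).
have [h rh hv] := normal_eigen VP nV rnum rden rB hden vB.
have := lim1 h rh hv; have := lim2 h rh hv.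
rewrite !xqE // !yqE // /grid_x /grid_y /= subrr mul0r [(y2 - y1) * _]mulrC.
have y0 : (y3 - y1) * (y2 - y1) != 0.
  by rewrite mulf_neq0 // subr_eq0 eq_sym.
rewrite -[RHS]mul1r => /(mulIf y0) -> /eqP; rewrite mul1r mulf_eq0 !subr_eq0.
by rewrite [x2 == x1]eq_sym (negPf x12).
Qed.
End Main.

(** * Choice of the grid *)

Section Grids.
Variables (k : closedFieldType) (m : nat).
Add Ring kringPZ : (rcarrier_theory k).

Lemma quadratic_root (b c : k) : exists z : k, z ^+ 2 = b * z + c.
Proof.
have [z hz] := @solve_monicpoly k 2 (fun i => if i == 0%N then c else b) isT.
exists z; rewrite hz !big_ord_recr big_ord0 /=; cring k.
Qed.

Lemma not_normal_neq3 : 3%:R != 0 :> k ->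
  ~ normal_variety (@veronese_compactification k 3 m.+4.+4).
Proof.
move=> c3; have [w hw] := quadratic_root (-1) (-1).
have w3 : w ^+ 3 = 1.
  transitivity ((w - 1) * (w ^+ 2 - (-1 * w + -1)) + 1); first by cring k.
  by rewrite hw subrr mulr0 add0r.
have w1 : w != 1.
  apply: contraNneq c3 => w1; move: hw; rewrite w1 => hw; apply/eqP.
  transitivity (1 ^+ 2 - (-1 * 1 + -1) : k); first by cring k.
  by rewrite hw subrr.
have w0 : w != 0.
  by apply: contraTneq isT => w0; move/eqP: w3; rewrite w0 expr0n eq_sym oner_eq0.
have w2 : w ^+ 2 != 1.
  apply: contraNneq w1 => w2; apply/eqP; rewrite -[RHS]w3 exprS w2 mulr1 //.
have w12 : w != w ^+ 2.
  apply: contraNneq w1 => w12; apply/eqP/(mulfI w0).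
  by rewrite mulr1 -expr2 -w12.
apply: (@not_normal_of_certificate k m 1 w (w ^+ 2) 1 w (w ^+ 2)); rewrite 1?[1 == _]eq_sym //.
have s0 : 1 + w + w ^+ 2 = 0 by rewrite hw; cring k.
have f0 : cubic_coef 1 w (w ^+ 2) 0 = -1 by rewrite /cubic_coef /= mul1r -exprS w3.
have f1 : cubic_coef 1 w (w ^+ 2) 1 = 0.
  by rewrite /cubic_coef /= !mul1r -exprS w3 -[RHS]s0; cring k.
have f2 : cubic_coef 1 w (w ^+ 2) 2 = 0 by rewrite /cubic_coef /= s0 oppr0.
move=> la mu nr ql qm.
apply: (node_rels_fermat c3 f0 f1 f2 _ f0 f1 f2 _ _ _ _ ql qm nr) => //.
all: rewrite /cross /plane_pt /grid_x /grid_y /= ?mul1r ?mulr1 mulf_neq0 // subr_eq0 //.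
all: by rewrite eq_sym // -?expr2.
Qed.

(** The ordinates 1, i, 1 + i with i^2 = -1 have vanishing second elementary symmetric
    function, and the abscissas 0, 1, -1 are the roots of X^3 - X, as required by
    [node_rels_char3]. *)
Lemma not_normal_char3 : 3%:R = 0 :> k ->
  ~ normal_variety (@veronese_compactification k 3 m.+4.+4).
Proof.
move=> c3; have [i hi] := quadratic_root 0 (-1).
rewrite mul0r add0r in hi.
have c2 : 2%:R = -1 :> k.
  by apply/eqP; rewrite -subr_eq0 opprK -[1]/(1%:R) -natrD c3.
have n11 : 1 != -1 :> k.
  by apply/eqP => e; have /eqP := c2; rewrite mulr2n {2}e subrr eq_sym oppr_eq0 oner_eq0.
have i0 : i != 0.
  by apply: contraTneq isT => i0; move/eqP: hi; rewrite i0 expr0n eq_sym oppr_eq0 oner_eq0.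
have i1 : i != 1 by apply: contraNneq n11 => i1; rewrite -hi i1 expr1n.
have i1' : 1 + i != 0.
  rewrite addrC addr_eq0; apply: contraNneq n11 => i1'; by rewrite -hi i1' sqrrN expr1n.
apply: (@not_normal_of_certificate k m 0 1 (-1) 1 i (1 + i)) => //.
- by rewrite eq_sym oner_eq0.
- by rewrite eq_sym oppr_eq0 oner_eq0.
- by rewrite eq_sym.
- by rewrite -subr_eq0 opprD addrA subrr sub0r oppr_eq0.
- by rewrite -subr_eq0 opprD addrCA subrr addr0 oppr_eq0 oner_eq0.
have f0 : cubic_coef 0 1 (-1) 0 = 0 :> k by rewrite /cubic_coef /= !mul0r oppr0.
have f1 : cubic_coef 0 1 (-1) 1 = -1 :> k by rewrite /cubic_coef /=; cring k.
have f2 : cubic_coef 0 1 (-1) 2 = 0 :> k by rewrite /cubic_coef /=; cring k.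
have g0 : cubic_coef 1 i (1 + i) 0 != 0.
  by rewrite /cubic_coef /= oppr_eq0 !mulf_neq0 // oner_neq0.
have g1 : cubic_coef 1 i (1 + i) 1 = 0.
  rewrite /cubic_coef /=; transitivity (3%:R * i + (i ^+ 2 - -1)); first by cring k.
  by rewrite c3 mul0r hi subrr addr0.
have g2 : cubic_coef 1 i (1 + i) 2 != 0.
  rewrite /cubic_coef /=; set d := (X in X != 0).
  have -> : d = - (2%:R * (1 + i)) by rewrite /d; cring k.
  by rewrite c2 mulN1r opprK.
move=> la mu nr ql qm.
apply: (node_rels_char3 c3 f0 f1 f2 _ g0 g1 g2 _ _ _ ql qm nr) => //.
- rewrite /cross /plane_pt /grid_x /grid_y /=; set d := (X in X != 0).
  have -> : d = i * (i - 1) by rewrite /d; cring k.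
  by rewrite mulf_neq0 // subr_eq0.
rewrite /cross /plane_pt /grid_x /grid_y /=; set d := (X in X != 0).
have -> : d = -1 by rewrite /d; cring k.
by rewrite oppr_eq0 oner_neq0.
Qed.
End Grids.

Theorem proposition4p28 (k : closedFieldType) (n : nat) (hn : (8 <= n)%N) :
  ~ normal_variety (@veronese_compactification k 3 n).
Proof.
have [m ->] : exists m, n = m.+4.+4 by exists (n - 8)%N; lia.
by have [c3|c3] := eqVneq (3%:R : k) 0; [exact: not_normal_char3|exact: not_normal_neq3].
Qed.
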